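(* A finite simple undirected graph $G$ is GaTEx if and only if every primitive induced subgraph of $G$ is a pseudo-cograph.
   Context: All graphs are finite, simple and undirected. A galled-tree on a finite nonempty set $X$ is a directed acyclic graph $N=(V,E)$ such that either $V=X=\{x\}$ and $E=\emptyset$, or: (N1) there is a unique root $\rho_N$ with indegree 0 and outdegree at least 2; (N2) $x\in X$ iff $x$ has outdegree 0 and indegree 1; (N3) every $v\in V\setminus X$ with $v\neq\rho_N$ has either indegree 1 and outdegree at least 2, or indegree 2 and outdegree at least 1 (hybrid-vertex); (N4) each biconnected component $C$ of $N$ contains at most one hybrid-vertex $v$ whose two in-neighbours both belong to $C$. For $x,y\in X$, $\mathrm{lca}_N(x,y)$ is the (in a galled-tree unique) minimal vertex, with respect to the ancestor order given by directed paths, that is an ancestor of both $x$ and $y$. A labeled galled-tree $(N,t)$ has a labeling $t:V\to\{0,1,\odot\}$ with $t(x)=\odot$ iff $x\in X$; it explains the graph on $X$ in which $\{x,y\}$ is an edge iff $t(\mathrm{lca}_N(x,y))=1$. A graph is GaTEx if it is isomorphic to a graph explained by some labeled galled-tree. A graph is primitive if it has at least four vertices and its only modules are the singletons and the whole vertex set, where a module is a vertex set $M$ with $N(x)\setminus M=N(y)\setminus M$ for all $x,y\in M$. A cograph is a graph with no induced path on four vertices. A graph $G$ is a pseudo-cograph if $|V(G)|\le 2$ or there are induced subgraphs $G_1,G_2$ of $G$ and a vertex $v$ such that (P1) $V(G)=V(G_1)\cup V(G_2)$, $V(G_1)\cap V(G_2)=\{v\}$, $|V(G_1)|>1$, $|V(G_2)|>1$;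 (P2) $G_1$ and $G_2$ are cographs; (P3) $G-v$ is either the join or the disjoint union of $G_1-v$ and $G_2-v$. *)

(* Defs.v *)
From mathcomp Require Import all_boot.

Set Implicit Arguments.
Unset Strict Implicit.
Unset Printing Implicit Defensive.

Section Graphs.

Definition simple_graph (T : finType) (e : rel T) : Prop :=
  symmetric e /\ irreflexive e.

Definition isomorphic (T U : finType) (e : rel T) (f : rel U) : Prop :=
  exists2 h : T -> U, bijective h & {mono h : x y / e x y >-> f x y}.

Variables (T : finType) (e : rel T).

Definition induced (A : {set T}) : rel {x : T | x \in A} :=
  [rel x y | e (val x) (val y)].

Definition nbh (x : T) : {set T} := [set y | e x y].

(* Modules are nonempty; otherwise set0 would vacuously be a nontrivial module
   of every graph and no graph would be primitive. *)
Definition is_module (M : {set T}) : Prop :=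
  M != set0 /\ {in M &, forall x y, nbh x :\: M = nbh y :\: M}.

Definition primitive : Prop :=
  4 <= #|T| /\
  forall M : {set T}, is_module M -> (exists x, M = [set x]) \/ M = [set: T].

Definition P4 : rel 'I_4 :=
  [rel i j : 'I_4 | (i.+1 == j :> nat) || (j.+1 == i :> nat)].

Definition cograph : Prop :=
  ~ exists2 h : 'I_4 -> T, injective h & {mono h : i j / P4 i j >-> e i j}.

(* Edge relations of the disjoint union and of the join of the induced
   subgraphs on A and B, for disjoint A and B. *)
Definition dunion_edge (A B : {set T}) : rel T :=
  [rel x y | ((x \in A) && (y \in A) || (x \in B) && (y \in B)) && e x y].

Definition join_edge (A B : {set T}) : rel T :=
  [rel x y | dunion_edge A B x y
             || ((x \in A) && (y \in B) || (x \in B) && (y \in A))].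

End Graphs.

Arguments induced {T} e A.

Definition pseudo_cograph (T : finType) (e : rel T) : Prop :=
  #|T| <= 2 \/
  exists (V1 V2 : {set T}) (v : T),
    [/\ [/\ V1 :|: V2 = [set: T], V1 :&: V2 = [set v], 1 < #|V1| & 1 < #|V2|],
        cograph (induced e V1) /\ cograph (induced e V2)
      & {in [set~ v] &, forall x y, e x y = join_edge e (V1 :\ v) (V2 :\ v) x y}
        \/
        {in [set~ v] &, forall x y,
           e x y = dunion_edge e (V1 :\ v) (V2 :\ v) x y}].

Section GalledTrees.

Variables (V : finType) (E : rel V).

Definition indeg (v : V) : nat := #|[set u | E u v]|.
Definition outdeg (v : V) : nat := #|[set w | E v w]|.

Definition acyclic : Prop := forall u v, E u v -> ~~ connect E v u.

Definition is_root (v : V) : bool := (indeg v == 0) && (2 <= outdeg v).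
Definition tree_vertex (v : V) : bool := (indeg v == 1) && (2 <= outdeg v).
Definition hybrid (v : V) : bool := (indeg v == 2) && (1 <= outdeg v).

(* Connectedness of the subgraph of the underlying undirected graph induced
   by C. *)
Definition connected_in (C : {set V}) : bool :=
  [forall x in C, forall y in C,
     connect [rel u w | [&& u \in C, w \in C & E u w || E w u]] x y].

Definition biconnected (C : {set V}) : bool :=
  [&& C != set0, connected_in C & [forall v in C, connected_in (C :\ v)]].

(* A maximal biconnected subgraph is induced, hence is given by its vertex
   set. *)
Definition biconnected_component (C : {set V}) : bool :=
  maxset [pred D : {set V} | biconnected D] C.

Definition galled_tree (X : {set V}) : Prop :=
  [/\ X != set0,
      acyclic
    & (exists x, [/\ [set: V] = [set x], X = [set x] & forall u v, ~~ E u v])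
      \/
      [/\ exists! r, is_root r,
          forall x, x \in X <-> outdeg x = 0 /\ indeg x = 1,
          forall v, v \notin X -> ~~ is_root v -> tree_vertex v \/ hybrid v
        & forall C, biconnected_component C ->
            {in C &, forall u v,
               hybrid u -> [set w | E w u] \subset C ->
               hybrid v -> [set w | E w v] \subset C -> u = v}]].

Definition common_ancestor (x y z : V) : bool := connect E z x && connect E z y.

Definition is_lca (x y z : V) : bool :=
  common_ancestor x y z &&
  [forall w, common_ancestor x y w && connect E z w ==> (w == z)].

Definition lca (x y : V) : option V := [pick z | is_lca x y z].

(* Some false, Some true and None stand for the labels 0, 1 and the leaf
   symbol, respectively. *)
Definition labeling (X : {set V}) (t : V -> option bool) : Prop :=
  forall x, t x = None <-> x \in X.

Definition explained (X : {set V}) (t : V -> option bool) :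
    rel {x : V | x \in X} :=
  [rel x y | (x != y) &&
     (if lca (val x) (val y) is Some z then t z == Some true else false)].

End GalledTrees.

Arguments explained {V} E X t.

Definition GaTEx (T : finType) (e : rel T) : Prop :=
  exists (V : finType) (E : rel V) (X : {set V}) (t : V -> option bool),
    [/\ galled_tree E X, labeling X t & isomorphic e (explained E X t)].

(* Main.v *)
(* In a galled tree, the gall of a hybrid h whose parents have lowest common
   ancestor z is the interval [z, h] of the ancestor order; it is biconnected,
   and two galls sharing two vertices have a biconnected union, so (N4) makes
   them have the same hybrid.  Hence lowest common ancestors are unique.

   If the explained graph is primitive on a leaf set A with lowest common
   ancestor z, modules coming from dominating vertices force A to hang off a
   single gall with top z, to have exactly one leaf v below its hybrid, and to
   have at most one leaf hanging off any other vertex of the gall.  The leaves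
   of one side of the gall together with v are then ordered so that each one
   sees all or none of its successors, which excludes an induced P4; leaves of
   different sides have lowest common ancestor z.

   Conversely, a nontrivial module is handled by substituting a network for a
   leaf, P4-free graphs are explained by trees since they or their complement
   are disconnected, and a pseudo-cograph (v, G1, G2) is explained by gluing the
   trees of G1 and G2 along the leaf v. *)

Require Import Defs.
From mathcomp Require Import all_boot.

Set Implicit Arguments.
Unset Strict Implicit.
Unset Printing Implicit Defensive.

(** The ancestors of a vertex of a galled tree need not form a chain, and the necessity argument
    controls this failure: two incomparable ancestors of a common vertex lie on opposite sides of
    one gall. Hence a vertex above a leaf that hangs off a gall is comparable with the gall vertex
    above that leaf, or else the leaf lies below the hybrid. The network is not pruned to the leaves
    of the primitive set; everything is phrased by comparisons in the ambient network. Sufficiency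
    is an induction over vertex subsets of one graph. The quotient by a module is realised by
    keeping one representative, so its primitive induced subgraphs are among those of the graph.
    Substitution turns a leaf into a cut vertex and therefore creates no new gall. Gluing creates
    one hybrid and is applied to hybrid-free trees only, which settles (N4). A root of outdegree at
    least two is built into the networks of the induction, so the one-vertex graph is treated
    apart. *)

(** * Reachability in an acyclic digraph *)

Section Connect.

Variables (V : finType) (E : rel V).

Local Notation "u <~ v" := (connect E u v) (at level 70).

Lemma connect_first u v : u <~ v -> u = v \/ exists2 w, E u w & w <~ v.
Proof.
case/connectP=> [[|w p]] /= => [_ ->|/andP[uw wp] ->]; first by left.
by right; exists w => //; apply/connectP; exists p.
Qed.

Lemma connect_last u v : u <~ v -> u = v \/ exists2 w, u <~ w & E w v.
Proof.
case/connectP=> p; case/lastP: p => [|p w] /= => [_ ->|]; first by left.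
rewrite rcons_path last_rcons => /andP[up pw] ->.
by right; exists (last u p) => //; apply/connectP; exists p.
Qed.

Lemma connect_last_ind (P : V -> Prop) u :
    P u -> (forall v w, u <~ v -> P v -> E v w -> P w) ->
  forall v, u <~ v -> P v.
Proof.
move=> Pu IH v /connectP[p + ->]; elim/last_ind: p => //= p w IHp.
rewrite rcons_path last_rcons => /andP[up pw]; apply: (IH (last u p)) => //.
  by apply/connectP; exists p.
exact: IHp.
Qed.

Lemma connect_first_ind (P : V -> Prop) v :
    P v -> (forall u w, w <~ v -> P w -> E u w -> P u) ->
  forall u, u <~ v -> P u.
Proof.
move=> Pv IH u /connectP[p]; elim: p u => [|w p IHp] u /= => [_ <- //|].
case/andP=> uw wp lp; apply: (IH u w) => //; last exact: IHp.
by apply/connectP; exists p.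
Qed.

Lemma connect_invariant (P : V -> Prop) u v :
  (forall x y, P x -> E x y -> P y) -> P u -> u <~ v -> P v.
Proof.
move=> cl Pu; apply: (connect_last_ind (P := P)) => // x y _; exact: cl.
Qed.

Hypothesis acE : acyclic E.

Lemma acyclic_edge u v : E u v -> ~ v <~ u.
Proof. by move=> uv; apply/negP/acE. Qed.

Lemma acyclic_irrefl u : ~ E u u.
Proof. by move/acyclic_edge; apply; exact: connect0. Qed.

Lemma connect_anti u v : u <~ v -> v <~ u -> u = v.
Proof.
move=> uv vu; case: (connect_first uv) => // [[w uw wv]].
by case: (acyclic_edge uw); exact: connect_trans vu.
Qed.

(** The number of descendants strictly decreases downwards; it is the measure that selects lowest
    and topmost vertices. *)
Lemma card_connect u w :
  u <~ w -> u != w -> #|[set x | w <~ x]| < #|[set x | u <~ x]|.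
Proof.
move=> uw nuw; apply/proper_card/properP; split.
  by apply/subsetP=> x; rewrite !inE; exact: connect_trans.
exists u; rewrite !inE ?connect0 //; apply: contra nuw => wu.
exact/eqP/connect_anti.
Qed.

Lemma ex_lowest (P : pred V) x :
  P x -> exists2 y, P y & forall w, P w -> y <~ w -> w = y.
Proof.
move=> Px; case: (arg_minnP (fun y => #|[set x | y <~ x]|) Px) => y Py min_y.
exists y => // w Pw yw; apply/eqP; case: (eqVneq w y) => // nwy.
have := card_connect yw; rewrite eq_sym => /(_ nwy).
by rewrite ltnNge min_y.
Qed.

Lemma ex_topmost (P : pred V) x :
  P x -> exists2 y, P y & forall w, P w -> w <~ y -> w = y.
Proof.
move=> Px; case: (arg_maxnP (fun y => #|[set x | y <~ x]|) Px) => y Py max_y.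
exists y => // w Pw wy; apply/eqP; case: (eqVneq w y) => // nwy.
by have := card_connect wy nwy; rewrite ltnNge; have /= -> := max_y w Pw.
Qed.

End Connect.

(** * Biconnected sets, order intervals and galls *)

Section Biconnected.

Variables (V : finType) (E : rel V).

Local Notation "u <~ v" := (connect E u v) (at level 70).

Definition link (C : {set V}) : rel V :=
  [rel u w | [&& u \in C, w \in C & E u w || E w u]].

Lemma link_sym C : symmetric (link C).
Proof. by move=> u w; rewrite /link /= andbCA [E u w || _]orbC. Qed.

Lemma connected_inP (C : {set V}) :
  reflect {in C &, forall x y, connect (link C) x y} (connected_in E C).
Proof.
apply: (iffP forall_inP) => [H x y xC yC|H x xC].
  by have /forall_inP := H x xC; apply.
by apply/forall_inP=> y yC; exact: H.
Qed.

Lemma link_connectS (A B : {set V}) x y :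
  A \subset B -> connect (link A) x y -> connect (link B) x y.
Proof.
move=> sAB; apply: connect_sub => u w /and3P[uA wA uw].
by apply: connect1; rewrite /link /= !(subsetP sAB).
Qed.

Lemma connected_inU (A B : {set V}) x : x \in A -> x \in B ->
  connected_in E A -> connected_in E B -> connected_in E (A :|: B).
Proof.
move=> xA xB /connected_inP cA /connected_inP cB; apply/connected_inP.
have key y : y \in A :|: B -> connect (link (A :|: B)) x y.
  case/setUP=> yC.
    by apply: (@link_connectS A); [exact: subsetUl|exact: cA].
  by apply: (@link_connectS B); [exact: subsetUr|exact: cB].
move=> y w /key xy /key xw; apply: connect_trans xw.
by rewrite sym_connect_sym //; exact: link_sym.
Qed.

Lemma biconnectedD (C : {set V}) v :
  biconnected E C -> connected_in E (C :\ v).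
Proof.
case/and3P=> _ cC /forall_inP cCv; case: (boolP (v \in C)) => [/cCv //|vC].
by rewrite (setDidPl _) // disjoint_sym disjoints1.
Qed.

(** Deleting one vertex leaves at least one of the two shared vertices, and this one still joins the
    two remainders. *)
Lemma biconnectedU (A B : {set V}) x y : x != y ->
    x \in A -> x \in B -> y \in A -> y \in B ->
  biconnected E A -> biconnected E B -> biconnected E (A :|: B).
Proof.
move=> nxy xA xB yA yB bA bB; apply/and3P; split.
- by apply/set0Pn; exists x; rewrite inE xA.
- by case/and3P: bA bB => _ cA _ /and3P[_ cB _]; exact: connected_inU xA xB cA cB.
apply/forall_inP=> v _; rewrite setDUl.
have [w [wA wB wv]] : exists w, [/\ w \in A, w \in B & w != v].
  by case: (eqVneq x v) => [xv|]; [exists y; rewrite -xv eq_sym|exists x].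
apply: (@connected_inU _ _ w); rewrite ?inE ?wv //; exact: biconnectedD.
Qed.

Definition itv (a b : V) : {set V} := [set w | (a <~ w) && (w <~ b)].

Lemma itvP a b w : reflect (a <~ w /\ w <~ b) (w \in itv a b).
Proof. by rewrite inE; exact: andP. Qed.

(** All vertices of a directed path from [a] to [b] belong to the interval. *)
Lemma itv_connect (C : {set V}) a b :
  a <~ b -> itv a b \subset C -> connect (link C) a b.
Proof.
move=> ab; elim/connect_first_ind: a / ab => [|a w wb IH aw sC].
  by rewrite connect0.
have aw' := connect1 aw.
have inC u : a <~ u -> u <~ b -> u \in C.
  by move=> au ub; apply: (subsetP sC); apply/itvP.
apply: (@connect_trans _ _ w).
  apply: connect1; rewrite /link /= aw !inC ?connect0 //.
  exact: connect_trans wb.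
apply: IH; apply/subsetP=> u /itvP[wu ub]; apply: inC => //.
exact: connect_trans wu.
Qed.

(* The gall of the hybrid [h] is the interval [itv z h]. *)
Definition gall z p1 p2 h : Prop :=
  [/\ p1 != p2, E p1 h, E p2 h, z <~ p1 /\ z <~ p2
    & forall w, z <~ w -> w <~ p1 -> w <~ p2 -> w = z].

Lemma gall_sym z p1 p2 h : gall z p1 p2 h -> gall z p2 p1 h.
Proof.
by case=> np e1 e2 [zp1 zp2] mz; split; rewrite 1?eq_sym // => w zw w2 w1; apply: mz.
Qed.

Hypothesis acE : acyclic E.

(** Delete [v]. A vertex [w] with [v] off [itv z w] stays linked to [z]; otherwise antisymmetry puts
    [v] off [itv w h], and [w] stays linked to [h]. If [v] is neither [z] nor [h], these two stay
    linked through one of the parents, since no gall vertex other than [z] is above both. *)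
Lemma gall_biconnected z p1 p2 h : gall z p1 p2 h -> biconnected E (itv z h).
Proof.
case=> np e1 e2 [zp1 zp2] mz.
have zh : z <~ h := connect_trans zp1 (connect1 e1).
have zI : z \in itv z h by apply/itvP.
have hI : h \in itv z h by apply/itvP.
have part (v a b : V) : z <~ a -> a <~ b -> b <~ h -> v \notin itv a b ->
    connect (link (itv z h :\ v)) a b.
  move=> za ab bh vab; apply: itv_connect => //; apply/subsetP=> u uab.
  rewrite !inE (contraNneq _ vab); last by move=> <-.
  case/itvP: uab => au ub.
  by rewrite (connect_trans za au) (connect_trans ub bh).
have cD v : connected_in E (itv z h :\ v).
  have sL := sym_connect_sym (link_sym (itv z h :\ v)).
  have up w : w \in itv z h :\ v -> v \notin itv z w ->
      connect (link (itv z h :\ v)) z w.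
    by case/setD1P=> _ /itvP[zw wh]; exact: part.
  have down w : w \in itv z h :\ v -> v \in itv z w ->
      connect (link (itv z h :\ v)) w h.
    case/setD1P=> nwv /itvP[zw wh] /itvP[_ vw]; apply: part => //.
    apply: contra nwv => /itvP[wv _]; exact/eqP/(connect_anti acE).
  have zhv : v != z -> v != h -> connect (link (itv z h :\ v)) z h.
    move=> vz vh.
    have step p : z <~ p -> E p h -> ~~ (v <~ p) ->
        connect (link (itv z h :\ v)) z h.
      move=> zp eph nvp; have ph := connect1 eph.
      have pI : p \in itv z h :\ v.
        rewrite in_setD1 (introT (itvP _ _ _)) // andbT.
        by apply: contraNneq nvp => ->.
      apply: (@connect_trans _ _ p).
        by apply: up => //; apply: contra nvp => /itvP[].
      by apply: connect1; rewrite /link /= pI eph in_setD1 eq_sym vh hI.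
    case: (boolP (v <~ p1)) => [v1|]; last exact: step.
    case: (boolP (v <~ p2)) => [v2|]; last exact: step.
    apply: (connect_trans (y := z)) => //.
    (* A vertex above both parents is [z] or lies outside the gall, where its deletion does no
       harm. *)
    case: (boolP (z <~ v)) => [zv|nzv]; first by rewrite (mz v) ?eqxx in vz.
    by apply: part => //; apply: contra nzv => /itvP[].
  have hub c : {in itv z h :\ v, forall w, connect (link (itv z h :\ v)) c w} ->
      connected_in E (itv z h :\ v).
    move=> H; apply/connected_inP=> x y xC yC.
    by apply: (connect_trans (y := c)); [rewrite sL|]; apply: H.
  case: (eqVneq v z) => [vz|nvz].
    apply: (hub h) => w wC; rewrite sL; apply: down => //.
    by case/setD1P: wC => _ /itvP[zw _]; apply/itvP; rewrite vz.
  case: (eqVneq v h) => [vh|nvh].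
    apply: (hub z) => w wC; apply: up => //; case/setD1P: wC => wv /itvP[zw wh].
    apply: contra wv => /itvP[_]; rewrite vh => hw.
    exact/eqP/(connect_anti acE).
  apply: (hub z) => w wC; case: (boolP (v \in itv z w)) => [vI|]; last exact: up.
  by apply: (connect_trans (zhv nvz nvh)); rewrite sL; exact: down.
apply/and3P; split; [by apply/set0Pn; exists z| |exact/forall_inP].
apply/connected_inP=> x y /itvP[zx xh] /itvP[zy yh].
apply: (connect_trans (y := z)); first rewrite (sym_connect_sym (link_sym _)).
  apply: itv_connect => //; apply/subsetP=> u /itvP[zu ux].
  by apply/itvP; split=> //; exact: connect_trans xh.
apply: itv_connect => //; apply/subsetP=> u /itvP[zu uy].
by apply/itvP; split=> //; exact: connect_trans yh.
Qed.

End Biconnected.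

(** Working form of the axioms outside the one-vertex case. The root is named, and (N4) ranges over
    all biconnected sets, which is equivalent because each of them lies in a maximal one. The
    converse half of (N2) follows from the degree conditions. *)
Definition rooted_galled_tree (V : finType) (E : rel V) (r : V) (X : {set V}) : Prop :=
  [/\ acyclic E,
      indeg E r = 0 /\ 1 < outdeg E r,
      {in X, forall x, outdeg E x = 0 /\ indeg E x = 1},
      forall v, v \notin X -> v != r -> tree_vertex E v \/ hybrid E v
    & forall C, biconnected E C ->
        {in C &, forall u v,
           hybrid E u -> [set w | E w u] \subset C ->
           hybrid E v -> [set w | E w v] \subset C -> u = v}].

Lemma galled_tree_rooted (V : finType) (E : rel V) (X : {set V}) :
  galled_tree E X -> #|V| = 1 \/ exists r, rooted_galled_tree E r X.
Proof.
case=> X0 acE [[x [Vx _ _]]|[[r [/andP[/eqP ir lor] r_uniq]] leafX inner N4]].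
  by left; rewrite -cardsT Vx cards1.
right; exists r; split=> // [x /leafX//|v vX nvr|C bC u v uC vC hu su hv sv].
  apply: inner => //; apply: contra nvr => rv.
  by apply/eqP; rewrite (r_uniq v).
have [D /[dup] maxD /maxsetP[bD _] sCD] := maxset_exists (P := [pred D | biconnected E D]) bC.
by apply: (N4 D maxD); rewrite ?(subsetP sCD) ?(subset_trans su) ?(subset_trans sv).
Qed.

Lemma rooted_galled_treeW (V : finType) (E : rel V) r (X : {set V}) :
  X != set0 -> rooted_galled_tree E r X -> galled_tree E X.
Proof.
move=> X0 [acE [ir lor] leafX inner N4]; split=> //; right; split.
- exists r; split=> [|v /andP[/eqP iv lov]]; first by rewrite /is_root ir.
  apply/eqP; rewrite eq_sym; apply/negP=> /negP nvr; case: (boolP (v \in X)).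
    by case/leafX; rewrite iv.
  by move/inner/(_ nvr); rewrite /tree_vertex /hybrid iv; case.
- move=> x; split=> [/leafX//|[ox ix]]; apply/negP=> /negP xX.
  case: (eqVneq x r) => [xr|]; first by rewrite xr ir in ix.
  by move/(inner _ xX); rewrite /tree_vertex /hybrid ox !andbF; case.
- move=> v vX nv; apply: inner => //; apply: contraNneq nv => ->.
  by rewrite /is_root ir.
by move=> C /maxsetP[bC _]; exact: N4.
Qed.

(** * Galls and lowest common ancestors in a galled tree *)

Section GalledTree.

Variables (V : finType) (E : rel V) (r : V) (X : {set V}).
Hypothesis gE : rooted_galled_tree E r X.

Local Notation "u <~ v" := (connect E u v) (at level 70).

Let acE : acyclic E. Proof. by case: gE. Qed.

Let anti u v : u <~ v -> v <~ u -> u = v. Proof. exact: connect_anti. Qed.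

(** A topmost ancestor of [v] has no parent, whereas every vertex other than [r] has one. *)
Lemma root_reaches v : r <~ v.
Proof.
have [y yv y_top] := ex_topmost acE (connect0 E v : [pred y | y <~ v] v).
suff <- : y = r by [].
apply/eqP/negP=> /negP nyr.
have : 0 < indeg E y.
  case: gE => _ _ leafX inner _; case: (boolP (y \in X)) => [/leafX[_ ->] //|].
  by case/inner/(_ nyr)=> /andP[/eqP->].
case/card_gt0P=> u; rewrite inE => uy.
have uv : u <~ v := connect_trans (connect1 uy) yv.
by have := y_top u uv (connect1 uy) => eq_uy; rewrite eq_uy in uy; case: (acyclic_irrefl acE uy).
Qed.

Lemma indeg_le2 v : indeg E v <= 2.
Proof.
case: gE => _ [ir _] leafX inner _; case: (eqVneq v r) => [->|nvr]; first by rewrite ir.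
case: (boolP (v \in X)) => [/leafX[_ ->] //|/inner/(_ nvr)].
by case=> /andP[/eqP->].
Qed.

Lemma indeg2_hybrid v : indeg E v = 2 -> hybrid E v.
Proof.
move=> iv; case: gE => _ [ir _] leafX inner _.
case: (eqVneq v r) => [vr|nvr]; first by rewrite vr ir in iv.
case: (boolP (v \in X)) => [/leafX[_]|/inner/(_ nvr)]; first by rewrite iv.
by case=> // /andP[]; rewrite iv.
Qed.

Lemma leaf_connect x v : x \in X -> x <~ v -> v = x.
Proof.
case: gE => _ _ leafX _ _ /leafX[/eqP + _] /connect_first[//|[w xw _]].
by rewrite cards_eq0 => /eqP/setP/(_ w); rewrite !inE xw.
Qed.

Lemma parents2 p1 p2 h : p1 != p2 -> E p1 h -> E p2 h -> [set w | E w h] = [set p1; p2].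
Proof.
move=> np e1 e2; apply/esym/eqP; rewrite eqEcard cards2 np indeg_le2 andbT.
by apply/subsetP=> w; rewrite !inE => /orP[]/eqP->.
Qed.

Lemma parents_hybrid p1 p2 h : p1 != p2 -> E p1 h -> E p2 h -> hybrid E h.
Proof.
by move=> np e1 e2; apply: indeg2_hybrid; rewrite /indeg (parents2 np e1 e2) cards2 np.
Qed.

Lemma ex_gall p1 p2 h : p1 != p2 -> E p1 h -> E p2 h -> exists z, gall E z p1 p2 h.
Proof.
move=> np e1 e2; have r12 : [pred z | (z <~ p1) && (z <~ p2)] r.
  by rewrite /= !root_reaches.
have [z /andP[z1 z2] min_z] := ex_lowest acE r12.
by exists z; split=> // w zw w1 w2; apply: min_z => //; rewrite /= w1.
Qed.

Section Gall.

Variables (z p1 p2 h : V).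
Hypothesis gz : gall E z p1 p2 h.

Lemma gall_parent_in q : E q h -> q \in itv E z h.
Proof.
case: gz => np e1 e2 [z1 z2] _ qh; have : q \in [set w | E w h] by rewrite inE.
rewrite (parents2 np e1 e2) => /set2P[]->; apply/itvP; split=> //; exact: connect1.
Qed.

Lemma gall_mem : h \in itv E z h.
Proof.
case: gz => _ e1 _ [z1 _] _; apply/itvP; split=> //; exact: connect_trans z1 (connect1 e1).
Qed.

Lemma gall_neq : h <> z.
Proof. by case: gz => _ e1 _ [z1 _] _ hz; apply: (acyclic_edge acE e1); rewrite hz. Qed.

Lemma gall_neq_parent w : w <~ p1 -> w <> h.
Proof. by case: gz => _ e1 _ _ _ + wh; rewrite wh; exact: acyclic_edge. Qed.

End Gall.

Lemma gall_inj z p1 p2 h z' p1' p2' h' x y : x != y ->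
    gall E z p1 p2 h -> gall E z' p1' p2' h' ->
    x \in itv E z h -> x \in itv E z' h' -> y \in itv E z h -> y \in itv E z' h' ->
  h = h'.
Proof.
move=> nxy g g' x1 x2 y1 y2.
have bU := biconnectedU nxy x1 x2 y1 y2 (gall_biconnected acE g) (gall_biconnected acE g').
case: gE => _ _ _ _ N4; apply: (N4 _ bU); rewrite ?in_setU ?(gall_mem g) ?(gall_mem g') ?orbT //.
- by case: g => np e1 e2 _ _; exact: parents_hybrid np e1 e2.
- by apply/subsetP=> w; rewrite !inE => /(gall_parent_in g)/itvP[-> ->].
- by case: g' => np e1 e2 _ _; exact: parents_hybrid np e1 e2.
by apply/subsetP=> w; rewrite !inE => /(gall_parent_in g')/itvP[-> ->]; rewrite orbT.
Qed.

(** Two parents would make [w] the hybrid of a second gall. That gall shares [w] and its parent [u]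
    with the given one, so [gall_inj] would give [w = h]. *)
Lemma gall_uniq_parent z p1 p2 h w q q' : gall E z p1 p2 h ->
  w \in itv E z h -> w <> z -> w <> h -> E q w -> E q' w -> q = q'.
Proof.
move=> g wI wz wh.
have [u zu uw] : exists2 u, z <~ u & E u w.
  by case/itvP: wI => /connect_last[/esym//|//].
suff key p : E p w -> p = u by move=> /key-> /key->.
move=> pw; apply/eqP/negP=> /negP npu; have [z' g'] := ex_gall npu pw uw; apply: wh.
have nwu : w != u by apply/eqP=> wu; rewrite wu in uw; exact: acyclic_irrefl uw.
have [_ wh] := itvP _ _ _ _ wI.
apply/esym/(gall_inj nwu g g' wI (gall_mem g')); last exact: gall_parent_in g' _ _.
by apply/itvP; split=> //; exact: connect_trans (connect1 uw) wh.
Qed.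

Lemma gall_parent z p1 p2 h w q : gall E z p1 p2 h ->
  w \in itv E z h -> w <> z -> E q w -> q \in itv E z h.
Proof.
move=> g wI wz qw; case: (eqVneq w h) => [wh|/eqP nwh].
  by apply: (gall_parent_in g); rewrite -wh.
have [zw wh] := itvP _ _ _ _ wI; case: (connect_last zw) => [/esym//|[u zu uw]].
rewrite (gall_uniq_parent g wI wz nwh qw uw); apply/itvP; split=> //.
exact: connect_trans (connect1 uw) wh.
Qed.

(** On the way up from [b] to [a] every vertex before [a] has a unique parent. An ancestor of [b] is
    therefore met on this way or lies above [a]. *)
Lemma gall_chain z p1 p2 h a b u : gall E z p1 p2 h ->
  z <~ a -> a <~ b -> b <~ p1 -> u <~ b -> u <~ a \/ a <~ u.
Proof.
move=> g za ab; elim/connect_last_ind: b / ab => [|b c ab IH bc c1 uc]; first by left.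
have [uc'|[q uq qc]] := connect_last uc.
  by right; rewrite uc'; exact: connect_trans ab (connect1 bc).
have [np e1 e2 _ _] := g.
have zb : z <~ b := connect_trans za ab.
have cI : c \in itv E z h.
  apply/itvP; split; first exact: connect_trans zb (connect1 bc).
  exact: connect_trans c1 (connect1 e1).
have cz : c <> z by move=> cz; apply: (acyclic_edge acE bc); rewrite cz.
have ch : c <> h := gall_neq_parent g c1.
apply: IH; first exact: connect_trans (connect1 bc) c1.
by rewrite -(gall_uniq_parent g cI cz ch qc bc).
Qed.

(** Take a topmost common descendant [h] of [u] and [w] above [x]. Paths from [u] and from [w] enter
    it through different parents, as a shared parent would be a higher common descendant; so [h] is
    a hybrid. By [gall_chain] on each side, the top of its gall is above [u] and [w]. *)
Lemma incomparable_gall u w x :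
    ~~ (u <~ w) -> ~~ (w <~ u) -> u <~ x -> w <~ x ->
  exists z p1 p2 h, [/\ gall E z p1 p2 h, h <~ x,
    [/\ z <~ u, u <> z & u <~ p1] & [/\ z <~ w, w <> z & w <~ p2]].
Proof.
move=> nuw nwu ux wx.
have Px : [pred y | [&& u <~ y, w <~ y & y <~ x]] x by rewrite /= ux wx connect0.
have [h /and3P[uh wh hx] h_top] := ex_topmost acE Px.
have [eh|[p1 up1 e1]] := connect_last uh; first by rewrite eh wh in nwu.
have [eh|[p2 wp2 e2]] := connect_last wh; first by rewrite eh uh in nuw.
have top y : u <~ y -> w <~ y -> y <~ h -> y = h.
  by move=> uy wy yh; apply: h_top => //=; rewrite uy wy (connect_trans yh hx).
have np : p1 != p2.
  apply/eqP=> p12; have p1h : p1 = h by apply: top (connect1 e1) => //; rewrite p12.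
  by apply: (@acyclic_irrefl _ _ acE h); rewrite -{1}p1h.
have [z g] := ex_gall np e1 e2; exists z, p1, p2, h.
have [_ _ _ [z1 z2] _] := g; have g' := gall_sym g.
have [_ zh] := itvP _ _ _ _ (gall_mem g).
have nzz : ~ (u <~ z /\ w <~ z).
  by case=> uz wz; apply: (gall_neq g); rewrite -(top z) //; case/itvP: (gall_mem g).
have zu : z <~ u.
  case: (gall_chain g (connect0 _ z) z1 (connect0 _ _) up1) => // uz.
  case: (gall_chain g' (connect0 _ z) z2 (connect0 _ _) wp2) => [wz|zw].
    by case: nzz.
  by rewrite (connect_trans uz zw) in nuw.
have zw : z <~ w.
  case: (gall_chain g' (connect0 _ z) z2 (connect0 _ _) wp2) => // wz.
  by rewrite (connect_trans wz zu) in nwu.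
split=> //; split=> // eqz; first by rewrite eqz zw in nuw.
by rewrite eqz zu in nwu.
Qed.

(** Uniqueness of lowest common ancestors rests on this. If [l] and [w] were incomparable, the gall
    they span above [x] and the one above [y] would share both vertices, hence the hybrid; this
    hybrid would be a common ancestor strictly below [l]. *)
Lemma lca_greatest x y l w : is_lca E x y l -> common_ancestor E x y w -> w <~ l.
Proof.
case/andP=> /andP[lx ly] /forallP l_min /andP[wx wy].
have low v : v <~ x -> v <~ y -> l <~ v -> v = l.
  by move=> vx vy lv; have /implyP := l_min v; rewrite /common_ancestor vx vy lv => /(_ isT)/eqP.
case: (boolP (w <~ l)) => // nwl; case: (boolP (l <~ w)) => [/(low w wx wy) wl|nlw].
  by rewrite wl connect0 in nwl.
have [z [p1 [p2 [h [g hx [zl _ lp1] [zw _ wp2]]]]]] := incomparable_gall nlw nwl lx wx.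
have [z' [q1 [q2 [h' [g' hy [zl' _ lq1] [zw' _ wq2]]]]]] := incomparable_gall nlw nwl ly wy.
have nlw' : l != w by apply: contraNneq nlw => ->.
have [_ e1 e2 _ _] := g; have [_ f1 f2 _ _] := g'.
have lh : l <~ h := connect_trans lp1 (connect1 e1).
have hh : h = h'.
  apply: (gall_inj nlw' g g'); apply/itvP; split=> //.
  - exact: connect_trans lq1 (connect1 f1).
  - exact: connect_trans wp2 (connect1 e2).
  - exact: connect_trans wq2 (connect1 f2).
have := low h hx; rewrite {1}hh => /(_ hy lh) hl.
by case: (gall_neq_parent g lp1).
Qed.

Lemma ex_lca x y : exists l, is_lca E x y l.
Proof.
have Pr : common_ancestor E x y r by rewrite /common_ancestor !root_reaches.
have [l Pl l_low] := ex_lowest acE Pr; exists l; rewrite /is_lca Pl /=.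
by apply/forallP=> w; apply/implyP=> /andP[Pw lw]; apply/eqP/l_low.
Qed.

Lemma lcaE x y l : is_lca E x y l -> lca E x y = Some l.
Proof.
rewrite /lca; case: pickP => [k kP lP|/(_ l)->//]; congr Some.
have [[ck _] [cl _]] := (andP kP, andP lP).
by apply: anti; [apply: (lca_greatest lP)|apply: (lca_greatest kP)].
Qed.

Lemma is_lca_uniq x y l l' : is_lca E x y l -> is_lca E x y l' -> l = l'.
Proof. by move/lcaE=> e /lcaE; rewrite e => -[]. Qed.

(* A vertex of the gall other than its top shares its in-edge with every gall
   through it, so an ancestor of [x] incomparable to it lies in the same gall. *)
Lemma gall_absorb z p1 p2 h w l x : gall E z p1 p2 h ->
    z <~ w -> w <> z -> w <~ h -> w <~ x -> l <~ x ->
  [\/ w <~ l, l <~ w | [/\ h <~ x, l <~ h & w <> h]].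
Proof.
move=> g zw wz wh wx lx.
case: (boolP (w <~ l)) => [|nwl]; first by constructor 1.
case: (boolP (l <~ w)) => [|nlw]; first by constructor 2.
have [z' [q1 [q2 [h' [g' hx [zw' wz' wq1] [zl' _ lq2]]]]]] := incomparable_gall nwl nlw wx lx.
have [_ f1 f2 _ _] := g'.
have wI' : w \in itv E z' h' by apply/itvP; split=> //; exact: connect_trans wq1 (connect1 f1).
case: (connect_last zw) => [/esym//|[q zq qw]].
have nwq : w != q by apply/eqP=> wq; rewrite -wq in qw; exact: acyclic_irrefl qw.
have hh : h = h'.
  apply: (gall_inj nwq g g'); rewrite ?(gall_parent g' wI' wz' qw) //; apply/itvP; split=> //.
  exact: connect_trans (connect1 qw) wh.
constructor 3; rewrite hh; split=> //; first exact: connect_trans lq2 (connect1 f2).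
exact: (gall_neq_parent g' wq1).
Qed.

End GalledTree.

(** * Induced subgraphs as vertex subsets of one graph *)

Section SubsetGraphs.

Variables (T : finType) (e : rel T).

(** The six adjacency conditions already force the four vertices to be distinct. *)
Definition p4free (S : {set T}) : Prop :=
  forall a b c d, a \in S -> b \in S -> c \in S -> d \in S ->
  e a b -> e b c -> e c d -> e a c = false -> e b d = false -> e a d = false ->
  False.

Definition module_in (S M : {set T}) : Prop :=
  {in M &, forall x y, {in S :\: M, forall w, e x w = e y w}}.

Definition primitive_in (S : {set T}) : Prop :=
  3 < #|S| /\ forall M : {set T}, M \subset S -> M != set0 -> module_in S M ->
    #|M| = 1 \/ M = S.

(** The value [b] merges the two cases of (P3): [true] is the join and [false] the disjoint union.
    The clause for at most two vertices is left out. *)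
Definition pseudo_cograph_in (S : {set T}) : Prop :=
  exists (S1 S2 : {set T}) (v : T) (b : bool),
    [/\ S1 :|: S2 = S, S1 :&: S2 = [set v], 1 < #|S1| /\ 1 < #|S2|,
        p4free S1 /\ p4free S2
      & {in S1 :\ v & S2 :\ v, forall x y, e x y = b}].

Lemma p4freeS (A B : {set T}) : A \subset B -> p4free B -> p4free A.
Proof. by move=> /subsetP sAB fB a b c d /sAB aB /sAB bB /sAB cB /sAB; exact: fB. Qed.

Hypotheses (sym_e : symmetric e) (irr_e : irreflexive e).

(** For any two vertices of the path, a third one is adjacent to exactly one of them. *)
Lemma p4_uniq a b c d : e a b -> e b c -> e c d -> e a c = false ->
  e b d = false -> e a d = false -> uniq [:: a; b; c; d].
Proof.
move=> ab bc cd ac bd ad; rewrite /= !inE !negb_or -!andbA andbT.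
have neq x y w : e w x -> e w y = false -> x != y.
  by move=> xw; apply: contraFneq => <-.
apply/and5P; split; last (apply/andP; split).
- by rewrite eq_sym; apply: (neq _ _ c); rewrite sym_e.
- by rewrite eq_sym; apply: (neq _ _ d); rewrite sym_e.
- by apply: (neq _ _ b); rewrite // sym_e.
- exact: (neq _ _ a).
- exact: (neq _ _ a).
- exact: (neq _ _ b).
Qed.

(** The embedding [g] will be [val \o val], because a pseudo-cograph decomposition of an induced
    subgraph takes induced subgraphs once more. *)
Lemma cograph_image (U : finType) (e' : rel U) (g : U -> T) (S : {set T}) :
    injective g -> {mono g : x y / e' x y >-> e x y} -> S = g @: [set: U] ->
  cograph e' <-> p4free S.
Proof.
move=> g_inj g_mono ->; split=> [cog|fr [h h_inj h_mono]].
  move=> _ _ _ _ /imsetP[a _ ->] /imsetP[b _ ->] /imsetP[c _ ->] /imsetP[d _ ->].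
  move=> ab bc cd ac bd ad; have := p4_uniq ab bc cd ac bd ad.
  rewrite -[[:: g a; _; _; _]]/(map g [:: a; b; c; d]) map_inj_uniq // => u.
  apply: cog; exists (fun i : 'I_4 => nth a [:: a; b; c; d] i).
    by move=> i j /eqP; rewrite nth_uniq // => /eqP/val_inj.
  have [ba cb dc] : [/\ e (g b) (g a), e (g c) (g b) & e (g d) (g c)].
    by split; rewrite sym_e.
  have [ca db da] : [/\ e (g c) (g a) = false, e (g d) (g b) = false & e (g d) (g a) = false].
    by split; rewrite sym_e.
  case=> [[|[|[|[|//]]]] i4]; case=> [[|[|[|[|//]]]] j4]; rewrite -g_mono ?irr_e //=.
pose i k := inord k : 'I_4.
apply: (fr (g (h (i 0))) (g (h (i 1))) (g (h (i 2))) (g (h (i 3)))); rewrite ?imset_f //;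
  by rewrite g_mono h_mono /P4 /= !inordK.
Qed.

Lemma primitive_induced (A : {set T}) : primitive (induced e A) <-> primitive_in A.
Proof.
rewrite /primitive /primitive_in card_sig cardE -cardE; split=> -[A4 mods]; split=> // M.
  move=> sMA /set0Pn[x0 x0M] modM.
  pose M' : {set {x : T | x \in A}} := [set x | val x \in M].
  have inM' x (xM : x \in M) : exists2 x' : {x | x \in A}, x' \in M' & x = val x'.
    by exists (Sub x (subsetP sMA x xM)); rewrite ?inE.
  case: (mods M').
  - split; first by have [x' + _] := inM' x0 x0M => x'M; apply/set0Pn; exists x'.
    move=> x y; rewrite !inE => xM yM; apply/setP=> w; rewrite !inE.
    case: (boolP (val w \in M)) => //= wM; apply: modM => //.
    by rewrite inE wM (valP w).
  - case=> x M'x; left; apply/eqP/cards1P; exists (val x); apply/setP=> y.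
    rewrite inE; apply/idP/eqP=> [/inM'[y' + ->]|->]; first by rewrite M'x => /set1P->.
    by have := set11 x; rewrite -M'x inE.
  move=> M'T; right; apply/eqP; rewrite eqEsubset sMA; apply/subsetP=> x xA.
  by have := in_setT (Sub x xA : {x | x \in A}); rewrite -M'T inE.
case=> /set0Pn[x0 x0M] modM.
have sMA : val @: M \subset A by apply/subsetP=> _ /imsetP[x _ ->]; exact: valP.
case: (mods _ sMA).
- by apply/set0Pn; exists (val x0); exact: imset_f.
- move=> _ _ /imsetP[x xM ->] /imsetP[y yM ->] w /setDP[wA wM].
  have /setP/(_ (Sub w wA)) := modM x y xM yM; rewrite !inE /=.
  case: (boolP (Sub w wA \in M)) => // wM'.
  by case/negP: wM; apply/imsetP; exists (Sub w wA).
- rewrite card_imset; last exact: val_inj.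
  by move/eqP/cards1P=> [x ->]; left; exists x.
move=> MA; right; apply/setP=> x; rewrite inE.
by have /setP/(_ (val x)) := MA; rewrite (valP x) (mem_imset _ _ val_inj).
Qed.

Lemma pseudo_cograph_induced (A : {set T}) : 2 < #|A| ->
  pseudo_cograph (induced e A) <-> pseudo_cograph_in A.
Proof.
move=> A2; split.
  case; first by rewrite card_sig leqNgt cardE -cardE A2.
  case=> V1 [V2 [v [[VT Vv c1 c2] [cog1 cog2] P3]]].
  have fr (V : {set {x : T | x \in A}}) :
      cograph (induced (induced e A) V) -> p4free (val @: V).
    apply: (cograph_image (g := val \o val) _ _ _).1 => //.
      exact: (inj_comp val_inj val_inj).
    apply/setP=> x; apply/imsetP/imsetP=> [[y yV ->]|[[y yV] _ ->]]; last by exists y.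
    by exists (Sub y yV).
  have diff (V : {set {x : T | x \in A}}) x :
      x \in (val @: V) :\ val v -> exists2 y, y \in V :\ v & x = val y.
    by case/setD1P=> + /imsetP[y yV xy]; rewrite xy (inj_eq val_inj) => nyv; exists y;
      rewrite // in_setD1 nyv.
  have notV (V W : {set {x : T | x \in A}}) x : V :&: W = [set v] ->
      x \in V :\ v -> (x \in W :\ v) = false.
    move=> VWv /setD1P[xv xV]; apply/negP=> /setD1P[_ xW].
    have : x \in V :&: W by rewrite inE xV.
    by rewrite VWv inE (negPf xv).
  have Vv' : V2 :&: V1 = [set v] by rewrite setIC.
  have U12 : val @: V1 :|: val @: V2 = A.
    rewrite -imsetU VT; apply/setP=> x; apply/imsetP/idP=> [[y _ ->]|xA]; first exact: valP.
    by exists (Sub x xA).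
  have I12 : val @: V1 :&: val @: V2 = [set val v].
    by rewrite -imsetI ?Vv ?imset_set1 // => ? ? _ _; exact: val_inj.
  case: P3 => P3; [exists (val @: V1), (val @: V2), (val v), true
                  |exists (val @: V1), (val @: V2), (val v), false].
    split; rewrite ?(card_imset _ val_inj) //; first by split; exact: fr.
    move=> _ _ /diff[x xV1 ->] /diff[y yV2 ->].
    have [[xv xV] [yv yV]] := (setD1P xV1, setD1P yV2).
    rewrite -[LHS]/(induced e A x y) P3 ?in_setC1 // /join_edge /dunion_edge /=.
    by rewrite xV1 yV2 orbT.
  split; rewrite ?(card_imset _ val_inj) //; first by split; exact: fr.
  move=> _ _ /diff[x xV1 ->] /diff[y yV2 ->].
  have [[xv xV] [yv yV]] := (setD1P xV1, setD1P yV2).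
  rewrite -[LHS]/(induced e A x y) P3 ?in_setC1 // /join_edge /dunion_edge /=.
  by rewrite (notV _ _ _ Vv xV1) (notV _ _ _ Vv' yV2) !andbF.
case=> S1 [S2 [v [b [SA Sv [c1 c2] [fr1 fr2] P3]]]].
have vA : v \in A by rewrite -SA inE; have := set11 v; rewrite -Sv inE => /andP[->].
pose res (S : {set T}) : {set {x : T | x \in A}} := [set x | val x \in S].
have resE (S : {set T}) : S \subset A -> S = val @: res S.
  move=> sSA; apply/setP=> x; apply/idP/imsetP=> [xS|[y + ->]]; last by rewrite inE.
  by exists (Sub x (subsetP sSA x xS)); rewrite ?inE.
have s1 : S1 \subset A by rewrite -SA subsetUl.
have s2 : S2 \subset A by rewrite -SA subsetUr.
have cog (S : {set T}) : S \subset A -> p4free S -> cograph (induced (induced e A) (res S)).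
  move=> sSA; apply: (cograph_image (g := val \o val) _ _ _).2 => //.
    exact: (inj_comp val_inj val_inj).
  rewrite {1}(resE _ sSA); apply/setP=> x; apply/imsetP/imsetP=> [[y yV ->]|[[y yV] _ ->]];
    last by exists y.
  by exists (Sub y yV).
have cardr (S : {set T}) : S \subset A -> #|res S| = #|S|.
  by move=> /resE {2}->; rewrite card_imset //; exact: val_inj.
right; exists (res S1), (res S2), (Sub v vA); split.
- split; rewrite ?cardr //.
    by apply/setP=> x; have /setP/(_ (val x)) := SA; rewrite !inE (valP x).
  apply/setP=> x; rewrite !inE; have /setP/(_ (val x)) := Sv.
  by rewrite !inE.
- by split; apply: cog.
have memD (S : {set T}) (x : {x | x \in A}) :
    (x \in res S :\ Sub v vA) = (val x \in S :\ v) by rewrite !inE.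
have notS x : x \in S1 :\ v -> (x \in S2 :\ v) = false.
  move=> /setD1P[xv xS]; apply/negP=> /setD1P[_ xS'].
  have : x \in S1 :&: S2 by rewrite inE xS.
  by rewrite Sv inE (negPf xv).
have cover (x : {x | x \in A}) : x != Sub v vA -> ~~ (val x \in S1 :\ v) -> val x \in S2 :\ v.
  rewrite -(inj_eq val_inj) /= => xv; rewrite !in_setD1 xv /= => xS1.
  by have /setP/(_ (val x)) := SA; rewrite inE (valP x) (negPf xS1).
(* The value [b] selects join or union. A vertex other than [v] lies in exactly one part, so four
   placements of [x] and [y] remain. *)
case: b P3 => P3; [left|right] => x y; rewrite !in_setC1 => xv yv;
rewrite /join_edge /dunion_edge /= !memD;
case: (boolP (val x \in S1 :\ v)) => x1; case: (boolP (val y \in S1 :\ v)) => y1;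
  rewrite ?(notS _ x1) ?(notS _ y1) ?(cover _ xv x1) ?(cover _ yv y1) /= ?orbF //.
- exact: (P3 _ _ x1 (cover _ yv y1)).
- by rewrite /induced /= sym_e; exact: (P3 _ _ y1 (cover _ xv x1)).
- exact: (P3 _ _ x1 (cover _ yv y1)).
- by rewrite /induced /= sym_e; exact: (P3 _ _ y1 (cover _ xv x1)).
Qed.

End SubsetGraphs.

(** * Necessity: primitive subsets of an explained graph *)

Section ExplainedPrimitive.

Variables (V : finType) (E : rel V) (r : V) (X : {set V}).
Hypothesis gE : rooted_galled_tree E r X.

Variables (T : finType) (e : rel T) (f : T -> V) (g : V -> bool).
Hypotheses (f_inj : injective f) (fX : forall x, f x \in X).
Hypothesis eE : forall x y l, x != y -> is_lca E (f x) (f y) l -> e x y = g l.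

Local Notation "u <~ v" := (connect E u v) (at level 70).

Let acE : acyclic E. Proof. by case: gE. Qed.
Let anti u v : u <~ v -> v <~ u -> u = v. Proof. exact: connect_anti. Qed.

(** As [y] is not below [s], both lowest common ancestors with [y] lie above [s]. Each is then a
    common ancestor of the other pair, and [lca_greatest] makes them equal. *)
Lemma module_in_dominated (s : V) x x' y : x != y -> x' != y ->
    s <~ f x -> s <~ f x' -> ~~ (s <~ f y) ->
    (forall l, l <~ f x -> s <~ l \/ l <~ s) ->
    (forall l, l <~ f x' -> s <~ l \/ l <~ s) ->
  e x y = e x' y.
Proof.
move=> xy x'y sx sx' nsy dx dx'.
have [l lP] := ex_lca gE (f x) (f y); have [l' lP'] := ex_lca gE (f x') (f y).
have [/andP[lx ly] _] := andP lP; have [/andP[lx' ly'] _] := andP lP'.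
have ls : l <~ s by case: (dx l lx) => // sl; rewrite (connect_trans sl ly) in nsy.
have ls' : l' <~ s by case: (dx' l' lx') => // sl; rewrite (connect_trans sl ly') in nsy.
have ll' : l = l'.
  apply: anti.
    by apply: (lca_greatest gE lP'); rewrite /common_ancestor ly (connect_trans ls sx').
  by apply: (lca_greatest gE lP); rewrite /common_ancestor ly' (connect_trans ls' sx).
by rewrite (eE xy lP) (eE x'y lP') ll'.
Qed.

Variables (A : {set T}).
Hypothesis primA : primitive_in e A.
Hypothesis sym_e : symmetric e.

(** Both [B] and [A :\: B] are modules. If both were nonempty, primitivity would make them
    singletons, against [3 < #|A|]. *)
Lemma primitive_in_split (B : {set T}) b : B \subset A ->
  {in B & A :\: B, forall x y, e x y = b} -> B = set0 \/ B = A.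
Proof.
move=> sBA const; case: primA => A4 mods.
case: (eqVneq B set0) => [|B0]; first by left.
case: (mods B) => // [x y xB yB w wB|B1|]; [by rewrite !const| |by right].
case: (eqVneq (A :\: B) set0) => [/eqP|D0].
  by rewrite setD_eq0 => sAB; right; apply/eqP; rewrite eqEsubset sBA.
have AE : A :\: (A :\: B) = B by rewrite setDDr setDv set0U; apply/setIidPr.
case: (mods (A :\: B)) => // [|x y xD yD w|D1|DA]; first exact: subsetDl.
- by rewrite AE => wB; rewrite !(sym_e _ w) !const.
- by have := cardsD A B; rewrite (setIidPr sBA) B1 D1; case: #|A| A4 => [|[|[|]]].
by move: AE B0; rewrite DA setDv => <-; rewrite eqxx.
Qed.

Let ltA : 3 < #|A|. Proof. by case: primA. Qed.

Lemma lowest_ancestor : exists z,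
  (forall a, a \in A -> z <~ f a) /\ forall w, z <~ w -> w <> z -> exists2 a, a \in A & ~~ (w
    <~ f a).
Proof.
have Pr : [pred z | [forall a in A, z <~ f a]] r.
  by apply/forall_inP=> a _; exact: (root_reaches gE).
have [z /forall_inP Pz z_low] := ex_lowest acE Pr; exists z; split=> // w zw wz.
apply/exists_inP; rewrite -negb_forall_in; apply/negP=> Pw; apply: wz.
exact: z_low.
Qed.

Variable z : V.
Hypothesis zA : forall a, a \in A -> z <~ f a.
Hypothesis z_low : forall w, z <~ w -> w <> z -> exists2 a, a \in A & ~~ (w <~ f a).

Lemma lowest_not_leaf a : z <> f a.
Proof.
move=> za; have : 1 < #|A| by exact: leq_trans ltA.
case/card_gt1P=> x [y [xA yA]]; case/negP; apply/eqP/f_inj.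
have fa w : w \in A -> f w = f a.
  by move=> wA; apply: (leaf_connect gE (fX a)); rewrite -za zA.
by rewrite !fa.
Qed.

(** Let [c] be a child of [z] and [B] the set of leaves below [c]. If every pair across [B] had [z]
    as lowest common ancestor, its adjacency would be constant, and [primitive_in_split] would put
    all of [A] below [c], although [z] is lowest. So some pair meets lower, below another child [c']
    of [z], and [c] and [c'] have a leaf in common. *)
Lemma ex_gall_at_lowest : exists p1 p2 h, gall E z p1 p2 h /\
  exists2 x, x \in A & exists w, [/\ z <~ w, w <> z, w <~ h & w <~ f x].
Proof.
have [a aA] : exists a, a \in A by apply/card_gt0P; exact: leq_trans ltA.
have [/lowest_not_leaf//|[c zc ca]] := connect_first (zA aA).
pose B := [set x in A | c <~ f x].
have cz : c <> z by move=> cz; rewrite cz in zc; exact: acyclic_irrefl zc.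
have sBA : B \subset A by apply/subsetP=> x; rewrite inE => /andP[].
case: (boolP [exists x in B, exists y in A :\: B, ~~ is_lca E (f x) (f y) z]); last first.
  rewrite negb_exists_in => /forall_inP H.
  case: (@primitive_in_split B (g z)) => // [x y xB yB|/setP/(_ a)|BA].
  - have := H x xB; rewrite negb_exists_in => /forall_inP/(_ y yB); rewrite negbK.
    apply: eE; apply: contraTneq yB => <-; by rewrite inE xB.
  - by rewrite !inE aA ca.
  have [b bA] := z_low (connect1 zc) cz.
  by move: bA; rewrite -BA inE => /andP[_ ->].
case/exists_inP=> x xB /exists_inP[y /setDP[yA yB] nzl].
move: xB yB; rewrite !inE yA /= => /andP[xA cx] ncy.
have [l lP] := ex_lca gE (f x) (f y).
have zl : z <~ l by apply: (lca_greatest gE lP); rewrite /common_ancestor !zA.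
have [zl'|[c' zc' c'l]] := connect_first zl; first by rewrite zl' lP in nzl.
have [/andP[lx ly] _] := andP lP.
have ncc' : ~~ (c <~ c').
  by apply: contra ncy => cc'; apply: connect_trans ly; apply: connect_trans c'l.
(* If [c'] is above [c], then [c] has both [z] and a vertex below [c'] as parents. The gall is
   degenerate: one of the two parents is its top [z]. *)
case: (boolP (c' <~ c)) => [c'c|nc'c].
  have [eqc|[q c'q qc]] := connect_last c'c; first by rewrite eqc connect0 in ncc'.
  have zq : z <~ q := connect_trans (connect1 zc') c'q.
  have nzq : z != q by apply/eqP=> eqz; apply: (acyclic_edge acE zc'); rewrite eqz.
  exists z, q, c; split; last by exists x => //; exists c; split=> //; exact: connect1.
  by split=> // w zw wz _; apply: anti.
have [z0 [p1 [p2 [h [gz0 hx [z0c cz0 c1] [z0c' _ c'2]]]]]] :=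
  incomparable_gall gE ncc' nc'c cx (connect_trans c'l lx).
have [_ e1 _ _ z0_min] := gz0.
have cI : c \in itv E z0 h by apply/itvP; split=> //; exact: connect_trans c1 (connect1 e1).
(* As a parent of [c], the vertex [z] belongs to the gall; being above both parents of the hybrid,
   it is the top. *)
have [z0z zh] := itvP _ _ _ _ (gall_parent gE gz0 cI cz0 zc).
have zz0 : z = z0.
  by apply: z0_min => //; [apply: connect_trans c1|apply: connect_trans c'2]; exact: connect1.
exists p1, p2, h; split; first by rewrite zz0.
exists x => //; exists c; split=> //; first exact: connect1.
by case/itvP: cI.
Qed.

(** The top is excluded because every leaf of [A] lies below it. *)
Definition in_gall h w := [/\ z <~ w, w <> z & w <~ h].

Section WithGall.

Variables (p1 p2 h : V).
Hypothesis gz : gall E z p1 p2 h.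
Hypothesis cover : forall y, y \in A -> exists2 w, in_gall h w & w <~ f y.

Definition hangs p y := exists w, [/\ in_gall h w, w <~ p & w <~ f y].

(** If the two gall vertices are comparable, the upper one is above both parents of the hybrid and
    equals [z]. If they are incomparable, [gall_absorb] puts [y] below the hybrid. *)
Lemma hangs2 y : hangs p1 y -> hangs p2 y -> h <~ f y.
Proof.
case=> w1 [[zw1 w1z w1h] w1p w1y] [w2 [[zw2 w2z w2h] w2p w2y]].
have [_ _ _ _ z_min] := gz.
case: (gall_absorb gE gz zw1 w1z w1h w1y w2y) => [w12|w21|[]//].
  by case: w1z; apply: z_min => //; exact: connect_trans w12 w2p.
by case: w2z; apply: z_min => //; exact: connect_trans w21 w1p.
Qed.

(** If [l] differs from [z], it is comparable with the gall vertex above [x], and the lower or the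
    upper of the two witnesses that [y] hangs off the same side. *)
Lemma hangs_lca x y l : is_lca E (f x) (f y) l -> hangs p1 x -> ~~ (h <~ f x) ->
  x \in A -> y \in A -> l = z \/ hangs p1 y.
Proof.
move=> lP [w [[zw wz wh] wp wx]] nhx xA yA.
case: (eqVneq l z) => [|/eqP lz]; first by left.
right; have [/andP[lx ly] _] := andP lP.
have zl : z <~ l by apply: (lca_greatest gE lP); rewrite /common_ancestor !zA.
case: (gall_absorb gE gz zw wz wh wx lx) => [wl|lw|[hx]]; last by rewrite hx in nhx.
  by exists w; split=> //; exact: connect_trans wl ly.
exists l; split=> //; last exact: connect_trans lw wp.
by split=> //; exact: connect_trans lw wh.
Qed.

Lemma in_gallP w : in_gall h w -> [\/ w <~ p1, w <~ p2 | w = h].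
Proof.
case=> zw wz /connect_last[->|[q wq qh]]; first by constructor 3.
have [np e1 e2 _ _] := gz.
have : q \in [set w | E w h] by rewrite inE.
by rewrite (parents2 gE np e1 e2) => /set2P[] <-; [constructor 1|constructor 2].
Qed.

Lemma hangs_cover y : y \in A -> [\/ hangs p1 y, hangs p2 y | h <~ f y].
Proof.
case/cover=> w wg wy; case: (in_gallP wg) => [wp|wp|<-]; last by constructor 3.
  by constructor 1; exists w.
by constructor 2; exists w.
Qed.

Lemma hybrid_comparable x l : h <~ f x -> l <~ f x -> h <~ l \/ l <~ h.
Proof.
move=> hx lx; have [zh _] := itvP _ _ _ _ (gall_mem gz).
case: (gall_absorb gE gz zh _ (connect0 _ _) hx lx) => [|||[_ _]//]; last by right.
- exact: (gall_neq gE gz).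
- by left.
Qed.

Lemma below_hybrid_module x x' y : h <~ f x -> h <~ f x' -> ~~ (h <~ f y) -> e x y = e x' y.
Proof.
move=> hx hx' nhy.
have ne w : h <~ f w -> w != y by move=> hw; apply: contraNneq nhy => <-.
by apply: (@module_in_dominated h) => //; rewrite ?ne // => l; exact: hybrid_comparable.
Qed.

(** Some leaf is not below [h]. If it hangs off the opposite side, let [c] be the topmost vertex
    there. As [z] is lowest, some leaf is not below [c]; it is neither below [h] nor on that side,
    whose vertices all lie below [c]. *)
Lemma hangs_nonempty : exists2 y, y \in A & ~~ (h <~ f y) /\ hangs p1 y.
Proof.
have [y yA yh] : exists2 y, y \in A & ~~ (h <~ f y).
  by apply: z_low; [case/itvP: (gall_mem gz)|exact: (gall_neq gE gz)].
have [|[w0 [[zw0 w0z w0h] w0p w0y]]|] := hangs_cover yA; [by exists y| |by rewrite (negPf yh)].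
have P0 : [pred w | [&& z <~ w, w != z & w <~ p2]] w0 by rewrite /= zw0 w0p andbT; exact/eqP.
have [c /and3P[zc /eqP cz cp] c_top] := ex_topmost acE P0.
have [a aA nca] := z_low zc cz; exists a => //.
have [_ _ e2 [_ z2] _] := gz.
have ch : c <~ h := connect_trans cp (connect1 e2).
have nha : ~~ (h <~ f a) by apply: contra nca; exact: connect_trans.
split=> //; have [//|[w [[zw wz wh] wp wa]]|] := hangs_cover aA; last by rewrite (negPf nha).
case/negP: nca; apply: (connect_trans (y := w)) => //.
case: (gall_chain gE (gall_sym gz) zc cp (connect0 _ _) wp) => // wc.
by rewrite (c_top w) //= zw wp andbT; exact/eqP.
Qed.

Definition on_side w := [&& z <~ w, w != z & w <~ p1].

Lemma on_side_in_gall w : on_side w -> in_gall h w.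
Proof.
have [_ e1 _ _ _] := gz; case/and3P=> zw /eqP wz w1; split=> //.
exact: connect_trans w1 (connect1 e1).
Qed.

Lemma on_sideP w : reflect (in_gall h w /\ w <~ p1) (on_side w).
Proof.
apply: (iffP idP) => [w1|[[zw wz _] w1]]; last by apply/and3P; split=> //; exact/eqP.
by split; [exact: on_side_in_gall|case/and3P: w1].
Qed.

Definition side := [set y in A | ~~ (h <~ f y) && [exists w, on_side w && (w <~ f y)]].

Lemma sideP y : reflect [/\ y \in A, ~~ (h <~ f y) & hangs p1 y] (y \in side).
Proof.
rewrite inE; apply: (iffP and3P) => [[yA hy /existsP[w /andP[/on_sideP[wg w1] wy]]]|[yA hy [w
  [wg w1 wy]]]].
  by split=> //; exists w.
by split=> //; apply/existsP; exists w; rewrite wy andbT; apply/on_sideP.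
Qed.

(** The attachment point of [y] on the side. *)
Definition low s y :=
  [&& on_side s, s <~ f y & [forall w, on_side w && (w <~ f y) ==> (w <~ s)]].

Lemma low_max s y w : low s y -> on_side w -> w <~ f y -> w <~ s.
Proof. by case/and3P=> _ _ /forallP/(_ w)/implyP H w1 wy; apply: H; rewrite w1. Qed.

Lemma on_side_chain s s' : on_side s -> on_side s' -> s <~ s' \/ s' <~ s.
Proof.
case/and3P=> zs _ s1 /and3P[_ _ s1'].
by case: (gall_chain gE gz zs s1 (connect0 _ _) s1'); [right|left].
Qed.

Lemma ex_low y : hangs p1 y -> exists s, low s y.
Proof.
case=> w0 [w0g w01 w0y].
have P0 : [pred w | on_side w && (w <~ f y)] w0.
  by rewrite /= w0y andbT; apply/on_sideP.
have [s /andP[s1 sy] s_low] := ex_lowest acE P0.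
exists s; rewrite /low s1 sy /=; apply/forallP=> w; apply/implyP=> /andP[w1 wy].
case: (on_side_chain s1 w1) => // sw.
by rewrite (s_low w) //= w1.
Qed.

Lemma low_comparable s x l : ~~ (h <~ f x) -> low s x -> l <~ f x -> s <~ l \/ l <~ s.
Proof.
move=> nhx /and3P[/on_side_in_gall[zs sz sh] sx _] lx.
by case: (gall_absorb gE gz zs sz sh sx lx) => [||[hx]]; [left|right|rewrite hx in nhx].
Qed.

(** The lowest common ancestor [l] is below [s]. Within the gall it can only be [s]: on the same
    side [s] is lowest above [x], and a vertex below [s] on the other side would force [s = z]. If
    [l] were below [s'], so would be [x], against the choice of [s] or, for [s' = h], against [x]
    not being below [h]. *)
Lemma low_lca s x s' y : ~~ (h <~ f x) -> low s x -> in_gall h s' ->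
    s <~ s' -> s' <> s -> on_side s' \/ s' = h -> s' <~ f y ->
  is_lca E (f x) (f y) s.
Proof.
move=> nhx lsx [zs' sz' sh'] ss' ns' s'1 s'y.
have [s1 sx _] := and3P lsx.
have [l lP] := ex_lca gE (f x) (f y); have [/andP[lx ly] _] := andP lP.
have sl : s <~ l.
  by apply: (lca_greatest gE lP); rewrite /common_ancestor sx (connect_trans ss' s'y).
suff <- : l = s by [].
have lh_s : l <~ h -> l = s.
  have [[zs sz sh] sp] := on_sideP _ s1; move=> lh.
  have lz : l <> z by move=> lz; apply: sz; apply: anti => //; rewrite -lz.
  have lg : in_gall h l by split=> //; exact: connect_trans zs sl.
  case: (in_gallP lg) => [l1|l2|eql]; last by rewrite -eql lx in nhx.
    by apply: anti => //; apply: (low_max lsx) => //; apply/on_sideP.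
  have [_ _ _ _ z_min] := gz.
  by case: sz; apply: z_min => //; exact: connect_trans sl l2.
case: (gall_absorb gE gz zs' sz' sh' s'y ly) => [s'l|ls'|[_ lh _]]; last exact: lh_s.
  have s'x : s' <~ f x := connect_trans s'l lx.
  case: s'1 => [s'1|eqs]; last by rewrite -eqs s'x in nhx.
  by case: ns'; apply: anti => //; exact: (low_max lsx).
by apply: lh_s; exact: connect_trans ls' sh'.
Qed.

Lemma hybrid_in_gall : in_gall h h.
Proof. by case/itvP: (gall_mem gz) => zh _; split=> //; exact: (gall_neq gE gz). Qed.

Lemma low_lca_hybrid s x y : x \in side -> low s x -> h <~ f y -> is_lca E (f x) (f y) s.
Proof.
case/sideP=> xA nhx _ lsx hy; have [/on_sideP[[_ _ sh] sp] _ _] := and3P lsx.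
apply: (low_lca nhx lsx hybrid_in_gall sh _ (or_intror erefl) hy).
by move=> hs; case: (gall_neq_parent gE gz sp).
Qed.

Variable v : T.
Hypotheses (vA : v \in A) (hv : h <~ f v).

(* The leaves hanging off one vertex of a side form a module avoiding [v]. *)
Lemma low_inj s x x' : x \in side -> x' \in side -> low s x -> low s x' -> x = x'.
Proof.
move=> xS x'S lx lx'; pose K := [set y in side | low s y].
have sKA : K \subset A by apply/subsetP=> y; rewrite inE => /andP[/sideP[]].
have xK : x \in K by rewrite inE xS.
have x'K : x' \in K by rewrite inE x'S.
have modK : module_in e A K.
  move=> a b aK bK y /setDP[yA yK].
  have ne c : c \in K -> c != y by move=> cK; apply: contraNneq yK => <-.
  have [[aS la] [bS lb]] := (setIdP aK, setIdP bK).
  have [_ nha _] := sideP _ aS; have [_ nhb _] := sideP _ bS.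
  have [s1 sa _] := and3P la; have [_ sb _] := and3P lb.
  (* A leaf [y] not below [s] cannot tell the members of [K] apart. A leaf [y] below [s] is attached
     strictly lower or lies below [h], and then meets each member of [K] in [s]. *)
  case: (boolP (s <~ f y)) => [sy|nsy]; last first.
    by apply: (@module_in_dominated s); rewrite ?ne // => l; exact: low_comparable.
  suff lca_s c : c \in side -> low s c -> is_lca E (f c) (f y) s.
    by rewrite (eE (ne _ aK) (lca_s a aS la)) (eE (ne _ bK) (lca_s b bS lb)).
  move=> cS lc; have [_ nhc _] := sideP _ cS.
  case: (boolP (h <~ f y)) => [hy|nhy]; first exact: low_lca_hybrid.
  have [y1|y2|] := hangs_cover yA; last by rewrite (negPf nhy).
    have [s' ls'] := ex_low y1; have [s'1 s'y _] := and3P ls'.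
    apply: (low_lca nhc lc (on_side_in_gall s'1) _ _ (or_introl s'1) s'y).
      exact: (low_max ls').
    by move=> eqs; case/negP: yK; rewrite inE -eqs ls' andbT; apply/sideP.
  case/negP: nhy; apply: hangs2 => //; exists s.
  by have [sg sp] := on_sideP _ s1.
case: primA => _ /(_ K sKA) []//; first by apply/set0Pn; exists x.
  by case/eqP/cards1P=> y Ky; move: xK x'K; rewrite Ky => /set1P-> /set1P->.
move=> KA; move: vA; rewrite -KA inE => /andP[/sideP[_]].
by rewrite hv.
Qed.

(** The leaf of [W] attached highest meets all others in its own attachment point, because
    attachment points are distinct by [low_inj]. Being isolated or dominating in [W], it shows that
    [v |: side] induces a threshold graph. *)
Lemma side_extreme (W : {set T}) : W \subset v |: side -> W != set0 ->
  exists2 x, x \in W & exists b, {in W, forall y, y != x -> e x y = b}.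
Proof.
move=> /subsetP sW /set0Pn[x0 x0W].
case: (boolP [exists x in W, x \in side]) => [/exists_inP[x1 x1W x1S]|]; last first.
  (* Without a side leaf [W] is the single vertex [v], and the value [true] is arbitrary. *)
  rewrite negb_exists_in => /forall_inP nS; exists x0 => //; exists true => y yW.
  have eqv w : w \in W -> w = v by move=> wW; have /setU1P[//|] := sW w wW;
    rewrite (negPf (nS w wW)).
  by rewrite (eqv x0) // (eqv y) // eqxx.
have [_ _ /ex_low[s0 ls0]] := sideP _ x1S.
have P0 : [pred s | [exists x in W, (x \in side) && low s x]] s0.
  by apply/exists_inP; exists x1; rewrite // x1S.
have [s /exists_inP[x xW /andP[xS lx]] s_top] := ex_topmost acE P0.
exists x => //; exists (g s) => y yW nyx; rewrite eq_sym in nyx.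
have [_ nhx _] := sideP _ xS; have [s1 sx _] := and3P lx.
apply: (eE nyx); have /setU1P[->|yS] := sW y yW; first exact: low_lca_hybrid.
have [_ _ /ex_low[s' ls']] := sideP _ yS; have [s'1 s'y _] := and3P ls'.
have ns : s' <> s.
  by move=> eqs; rewrite eqs in ls'; rewrite (low_inj xS yS lx ls') eqxx in nyx.
apply: (low_lca nhx lx (on_side_in_gall s'1) _ ns (or_introl s'1) s'y).
case: (on_side_chain s1 s'1) => // s's; case: ns; apply: s_top => //.
by apply/exists_inP; exists y; rewrite // yS.
Qed.

(** Each vertex of an induced P4 has both a neighbour and a non-neighbour in it, so none is
    extreme. *)
Lemma p4free_side : p4free e (v |: side).
Proof.
move=> a b c d aS bS cS dS ab bc cd ac bd ad.
have := p4_uniq sym_e ab bc cd ac bd ad; rewrite /= !inE !negb_or -!andbA andbT.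
case/and5P=> nab nac nad nbc /andP[nbd ncd].
pose W := [set a; b; c; d].
have [||x xW [b0 xb]] := @side_extreme W.
- by apply/subsetP=> w; rewrite in_setU in_set1 !inE -!orbA => /or4P[]/eqP->;
    move: aS bS cS dS; rewrite !inE.
- by apply/set0Pn; exists a; rewrite !inE eqxx.
have WP : [/\ a \in W, b \in W, c \in W & d \in W] by rewrite !inE !eqxx !orbT.
have [aW bW cW dW] := WP.
move: xW; rewrite !inE -!orbA => /or4P[]/eqP eqx; rewrite eqx in xb.
- by have := xb c cW; rewrite ac -(xb b bW) ?ab eq_sym // => /(_ nac).
- by have := xb d dW; rewrite bd -(xb c cW) ?bc eq_sym // => /(_ nbd).
- by have := xb a aW; rewrite sym_e ac -(xb b bW) 1?sym_e ?bc // => /(_ nac).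
- by have := xb a aW; rewrite sym_e ad -(xb c cW) 1?sym_e ?cd // => /(_ nad).
Qed.

End WithGall.

(** A leaf below a vertex of the gall other than [z] and a leaf below no such vertex meet in [z]: by
    [gall_absorb], any other meeting point yields such a vertex above the second leaf. The adjacency
    across is thus constant, and [primitive_in_split] leaves only one class. *)
Lemma lowest_cover p1 p2 h : gall E z p1 p2 h ->
    (exists2 x, x \in A & exists w, [/\ z <~ w, w <> z, w <~ h & w <~ f x]) ->
  forall y, y \in A -> exists2 w, in_gall h w & w <~ f y.
Proof.
move=> gz [x0 x0A [w0 [zw0 w0z w0h w0x]]] y yA.
pose B := [set y in A | [exists w, [&& z <~ w, w != z, w <~ h & w <~ f y]]].
have inB y' w : y' \in A -> z <~ w -> w <> z -> w <~ h -> w <~ f y' -> y' \in B.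
  move=> y'A zw /eqP wz wh wy; rewrite inE y'A; apply/existsP; exists w.
  by rewrite zw wz wh.
suff [B0|BA] : B = set0 \/ B = A.
- by have := inB x0 w0 x0A zw0 w0z w0h w0x; rewrite B0 inE.
- move: yA; rewrite -BA inE => /andP[_ /existsP[w /and4P[zw /eqP wz wh wy]]].
  by exists w.
apply: (@primitive_in_split B (g z)) => [|x y' xB /setDP[y'A y'B]].
  by apply/subsetP=> x; rewrite inE => /andP[].
have nxy : x != y' by apply: contraNneq y'B => <-.
move: xB; rewrite inE => /andP[xA /existsP[w /and4P[zw /eqP wz wh wx]]].
have [l lP] := ex_lca gE (f x) (f y'); have [/andP[lx ly] _] := andP lP.
rewrite (eE nxy lP); congr g; apply/eqP/negP=> /negP/eqP lz; case/negP: y'B.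
have zl : z <~ l by apply: (lca_greatest gE lP); rewrite /common_ancestor !zA.
case: (gall_absorb gE gz zw wz wh wx lx) => [wl|lw|[_ lh _]].
- by apply: (inB _ w) => //; exact: connect_trans wl ly.
- by apply: (inB _ l) => //; exact: connect_trans lw wh.
exact: (inB _ l).
Qed.

Lemma pseudo_cograph_in_lowest : pseudo_cograph_in e A.
Proof.
have [p1 [p2 [h [gz /(lowest_cover gz) cov]]]] := ex_gall_at_lowest.
have gz' := gall_sym gz.
pose A1 := side p1 h; pose A2 := side p2 h; pose H := [set y in A | h <~ f y].
have sideS p : side p h \subset A by apply/subsetP=> y; rewrite inE => /andP[].
have cross x y : x \in A1 -> y \in A2 -> x != y /\ e x y = g z.
  move=> /(sideP gz)[xA nhx x1] /(sideP gz')[yA nhy y2].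
  have nxy : x != y by apply: contraNneq nhx => eqxy; apply: (hangs2 gz) => //; rewrite eqxy.
  split=> //; have [l lP] := ex_lca gE (f x) (f y); rewrite (eE nxy lP).
  case: (hangs_lca gz lP x1 nhx xA yA) => [-> //|y1].
  by rewrite (hangs2 gz y1 y2) in nhy.
have UA y : y \in A -> [\/ y \in A1, y \in A2 | y \in H].
  move=> yA; case: (boolP (h <~ f y)) => [hy|nhy]; first by constructor 3; rewrite inE yA.
  case: (hangs_cover gz cov yA) => [y1|y2|]; last by rewrite (negPf nhy).
    by constructor 1; apply/(sideP gz).
  by constructor 2; apply/(sideP gz').
have [a1 a1A [na1 a1p]] := hangs_nonempty gz cov.
have [a2 a2A [na2 a2p]] := hangs_nonempty gz' cov.
have a1S : a1 \in A1 by apply/(sideP gz).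
have a2S : a2 \in A2 by apply/(sideP gz').
have nH : H != A.
  by apply: contraNneq na1 => HA; move: a1A; rewrite -HA inE => /andP[].
(* With no leaf below [h], the two nonempty sides would partition [A] with constant adjacency [g z]
   across. *)
have H0 : H != set0.
  apply/negP=> /eqP H0; case: (@primitive_in_split A1 (g z) (sideS p1)) => [x y xA1 /setDP[yA
    yA1]|A10|A1A].
  - case: (UA y yA) => [|yA2|]; [by rewrite (negPf yA1)| |by rewrite H0 inE].
    by case: (cross x y xA1 yA2).
  - by rewrite A10 inE in a1S.
  have : a2 \in A1 by rewrite A1A.
  by move=> a21; case: (cross a2 a2 a21 a2S); rewrite eqxx.
have [v Hv] : exists v, H = [set v].
  apply/cards1P; apply/eqP.
  have sHA : H \subset A by apply/subsetP=> y; rewrite inE => /andP[].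
  case: primA => _ /(_ H sHA H0) []//; last by move/eqP; rewrite (negPf nH).
  move=> x x' /setIdP[xA hx] /setIdP[x'A hx'] y /setDP[yA yH].
  by apply: (below_hybrid_module gz) => //; apply: contra yH => hy; rewrite inE yA.
have /setIdP[vA hv] : v \in H by rewrite Hv set11.
have nv p : v \notin side p h by rewrite inE vA hv.
exists (v |: A1), (v |: A2), v, (g z); split.
- apply/eqP; rewrite eqEsubset !subUset !sub1set vA !sideS /=; apply/subsetP=> y /UA.
  by rewrite Hv !inE; case=> ->; rewrite ?orbT.
- rewrite -setUIr; apply/setP=> y; rewrite in_setU1 in_set1 orb_idr // => /setIP[y1 y2].
  by case: (cross y y y1 y2); rewrite eqxx.
- by rewrite !cardsU1 !nv; split; rewrite ltnS; apply/card_gt0P; [exists a1|exists a2].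
- by split; [apply: (p4free_side gz cov)|apply: (p4free_side gz')].
move=> x y /setD1P[xv /setU1P[|xA1]]; first by move/eqP; rewrite (negPf xv).
by case/setD1P=> yv /setU1P[/eqP|yA2]; [rewrite (negPf yv)|case: (cross x y)].
Qed.

End ExplainedPrimitive.

Lemma explained_primitive (V : finType) (E : rel V) (r : V) (X : {set V})
    (T : finType) (e : rel T) (f : T -> V) (g : V -> bool) :
    rooted_galled_tree E r X -> injective f -> (forall x, f x \in X) ->
    (forall x y l, x != y -> is_lca E (f x) (f y) l -> e x y = g l) ->
    symmetric e ->
  forall A, primitive_in e A -> pseudo_cograph_in e A.
Proof.
move=> gE f_inj fX eE sym_e A primA.
have [z [zA z_low]] := lowest_ancestor gE f A.
exact: (pseudo_cograph_in_lowest gE f_inj fX eE primA sym_e zA z_low).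
Qed.

(** * Splitting P4-free graphs *)

Section CographSplit.

Variables (T : finType) (e : rel T).
Hypothesis sym_e : symmetric e.

(** For [b = false] the graph on [S] is disconnected, for [b = true] its complement is. *)
Definition splits (S B : {set T}) : Prop :=
  [/\ B \subset S, B != set0, B != S
    & exists b, {in B & S :\: B, forall x y, e x y = b}].

Lemma splits_properI (S B : {set T}) b x y : B \subset S -> x \in B -> y \in S -> y \notin B ->
  (forall u w, u \in B -> w \in S -> w \notin B -> e u w = b) -> splits S B.
Proof.
move=> sBS xB yS yB const; split=> //; first by apply/set0Pn; exists x.
  by apply: contraNneq yB => ->.
by exists b => u w uB /setDP[wS wB]; exact: const.
Qed.

(** Suppose [v] has relation [b] to some vertex of [D]. If it has relation [b] to all of [F], then
    [F] splits off. Otherwise the set [N] of vertices of [D] in relation [b] to [v] splits off,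
    unless some [w] in [N] and [u] in [D :\: N] are not in relation [b]; then [v], [w], [x], [u],
    with [x] in [F] not in relation [b] to [v], is a P4 of the graph or of its complement. *)
Lemma p4free_extend (S D F : {set T}) v b : p4free e S -> v \in S ->
    S :\ v = D :|: F -> [disjoint D & F] -> D != set0 -> F != set0 ->
    {in D & F, forall x y, e x y = b} ->
  (exists B, splits S B) \/ {in D, forall w, e v w != b}.
Proof.
move=> frS vS SDF dDF /set0Pn[d dD] /set0Pn[f fF] const.
have DF x : x \in D -> x \notin F by move=> xD; rewrite (disjointFr dDF).
have FD x : x \in F -> x \notin D by move=> xF; rewrite (disjointFl dDF).
have vDF : v \notin D :|: F by rewrite -SDF !inE eqxx.
have [vD vF] : v \notin D /\ v \notin F by apply/andP; rewrite -negb_or -in_setU.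
have inS x : x \in S -> [\/ x = v, x \in D | x \in F].
  move=> xS; case: (eqVneq x v) => [|xv]; first by constructor 1.
  have : x \in D :|: F by rewrite -SDF !inE xv.
  by case/setUP; [constructor 2|constructor 3].
have SD : D \subset S by apply/subsetP=> x xD; have := subsetUl D F;
  rewrite -SDF => /subsetP/(_ x xD)/setD1P[].
have SF : F \subset S by apply/subsetP=> x xF; have := subsetUr D F;
  rewrite -SDF => /subsetP/(_ x xF)/setD1P[].
have [/subsetP SD' /subsetP SF'] := (SD, SF).
case: (boolP [forall w in D, e v w != b]) => [/forall_inP|]; first by right.
rewrite negb_forall_in => /exists_inP[n nD]; rewrite negbK => /eqP vn; left.
case: (boolP [forall w in F, e v w == b]) => [/forall_inP vFb|].
  exists F; apply: (@splits_properI S F b f d) => //; rewrite ?DF ?SD' // => u w uF wS wF.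
  case: (inS w wS) => [->|wD|]; last by rewrite (negPf wF).
    by rewrite sym_e; apply/eqP/vFb.
  by rewrite sym_e; exact: const.
rewrite negb_forall_in => /exists_inP[x xF vx].
pose N := [set w in D | e v w == b].
case: (boolP [forall w in N, forall u in D :\: N, e w u == b]) => [/forall_inP Nb|].
  exists N; apply: (@splits_properI S N b n v); rewrite ?inE ?nD ?vn ?eqxx ?(negPf vD) //.
    by apply: subset_trans SD; apply/subsetP=> w; rewrite inE => /andP[].
  move=> u w uN wS wN; case: (setIdP uN) => uD /eqP vu.
  case: (inS w wS) => [->|wD|wF]; [by rewrite sym_e| |exact: const].
  by have /forall_inP/(_ w) := Nb u uN; rewrite in_setD wN wD => /(_ isT)/eqP.
rewrite negb_forall_in => /exists_inP[w wN];
  rewrite negb_forall_in => /exists_inP[u /setDP[uD uN] wu].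
have [wD /eqP vw] := setIdP wN.
have vu : e v u != b by move: uN; rewrite inE uD.
have [wx ux] : e w x = b /\ e u x = b by split; exact: const.
have wS := SD' w wD; have uS := SD' u uD; have xS := SF' x xF.
exfalso; case: b vw vu wx ux wu vx {const vn n N nD wN uN} => vw; rewrite ?eqb_id ?eqbF_neg ?negbK.
- move=> /negPf vu wx ux /negPf wu /negPf vx.
  by apply: (frS v w x u); rewrite // sym_e.
(* The complement of a P4 is again a P4, here traversed as [w], [u], [v], [x]. *)
move=> vu wx ux wu vx; by apply: (frS w u v x); rewrite // sym_e.
Qed.

(** Delete [v] and split the rest into [B] and [C]. If [p4free_extend] yields no split from either
    side, then [v] has relation [~~ b] to all other vertices, and [[set v]] splits off. *)
Lemma p4free_split (S : {set T}) : p4free e S -> 1 < #|S| -> exists B, splits S B.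
Proof.
move: {2}#|S| (leqnn #|S|) => n; elim: n S => [|n IH] S; first by rewrite leqn0 => /eqP->.
move=> leSn frS S2; have /card_gt0P[v vS] : 0 < #|S| by exact: ltnW.
have cS : #|S| = #|S :\ v|.+1 by rewrite (cardsD1 v) vS.
have [S1|nS1] := eqVneq #|S :\ v| 1.
  have [w Sw] := cards1P (introT eqP S1).
  have /setD1P[wv wS] : w \in S :\ v by rewrite Sw set11.
  exists [set v]; apply: (@splits_properI _ _ (e v w) v w); rewrite ?inE ?sub1set //.
  move=> u x /set1P-> xS; rewrite inE => xv.
  by have : x \in S :\ v; [rewrite !inE xv|rewrite Sw => /set1P->].
have [|||B [sB B0 BS [b const]]] := IH (S :\ v).
- by rewrite -ltnS -cS.
- exact: (p4freeS (subsetDl _ _) frS).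
- by rewrite ltn_neqAle eq_sym nS1 -ltnS -cS.
pose C := (S :\ v) :\: B.
have C0 : C != set0 by rewrite setD_eq0; apply: contra BS => sSB; rewrite eqEsubset sB.
have SBC : S :\ v = B :|: C by rewrite -(setID (S :\ v) B) (setIidPr sB).
have dBC : [disjoint B & C].
  by rewrite -setI_eq0; apply/eqP/setP=> x; rewrite !inE; case: (x \in B).
have [//|vB] := p4free_extend frS vS SBC dBC B0 C0 const.
have [||x y xC yB|//|vC] := @p4free_extend S C B v b frS vS _ _ C0 B0.
- by rewrite setUC.
- by rewrite disjoint_sym.
- by rewrite sym_e; exact: const.
have [w wB] := set0Pn _ B0; have /setD1P[wv wS] := subsetP sB w wB.
exists [set v]; apply: (@splits_properI _ _ (~~ b) v w); rewrite ?inE ?sub1set //.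
move=> u x /set1P-> xS; rewrite inE => xv.
have : x \in B :|: C by rewrite -SBC !inE xv.
by case/setUP=> [/vB|/vC]; case: (e v x) b {const vB vC} => [] [].
Qed.

End CographSplit.

(** * Pulling biconnected sets back along an embedding *)

Section Embedding.

Variables (U V : finType) (EU : rel U) (EV : rel V) (phi : U -> V).
Hypothesis phi_inj : injective phi.
Hypothesis phiE : forall x y, EV (phi x) (phi y) = EU x y.

Lemma connect_homo x y : connect EU x y -> connect EV (phi x) (phi y).
Proof.
move=> xy; elim/connect_last_ind: y / xy => [|y w _ IH yw]; first exact: connect0.
by apply: connect_trans IH _; apply: connect1; rewrite phiE.
Qed.

Lemma preim_connected_in (C : {set V}) : C \subset phi @: [set: U] ->
  connected_in EV C -> connected_in EU (phi @^-1: C).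
Proof.
move=> /subsetP sC /connected_inP cC; apply/connected_inP=> x y; rewrite !inE => xC yC.
have : exists2 y', phi y = phi y' & connect (link EU (phi @^-1: C)) x y'.
  apply: (connect_invariant (P := fun v => exists2 y', v = phi y' &
             connect (link EU (phi @^-1: C)) x y')) (cC _ _ xC yC).
    move=> _ w [u -> xu] /and3P[uC wC]; have /imsetP[w' _ eqw] := sC w wC.
    rewrite eqw !phiE => uw; exists w' => //; apply: connect_trans xu (connect1 _).
    by rewrite /link /= !inE uC -eqw wC.
  by exists x.
by case=> y' /phi_inj->.
Qed.

Lemma preim_biconnected (C : {set V}) : C \subset phi @: [set: U] ->
  biconnected EV C -> biconnected EU (phi @^-1: C).
Proof.
move=> sC bC; have [/set0Pn[c cC] conC _] := and3P bC; apply/and3P; split.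
- have /imsetP[x _ eqc] := subsetP sC c cC.
  by apply/set0Pn; exists x; rewrite inE -eqc.
- exact: preim_connected_in.
apply/forall_inP=> x _.
have -> : phi @^-1: C :\ x = phi @^-1: (C :\ phi x).
  by apply/setP=> y; rewrite !inE (inj_eq phi_inj).
apply: preim_connected_in; last exact: biconnectedD.
by apply: subset_trans sC; exact: subsetDl.
Qed.

End Embedding.

Lemma is_lca_sym (V : finType) (E : rel V) x y l : is_lca E x y l -> is_lca E y x l.
Proof.
case/andP=> xyl /forallP l_min; apply/andP; split; first by rewrite /common_ancestor andbC.
by apply/forallP=> w; have := l_min w; rewrite /common_ancestor [connect E w x && _]andbC.
Qed.

Lemma is_lcaP (V : finType) (E : rel V) x y l :
  reflect [/\ connect E l x, connect E l y
            & forall w, connect E l w -> connect E w x -> connect E w y -> w = l]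
    (is_lca E x y l).
Proof.
apply: (iffP andP) => [[/andP[lx ly] /forallP l_min]|[lx ly l_min]]; split=> //.
- move=> w lw wx wy; have /implyP := l_min w.
  by rewrite /common_ancestor lw wx wy => /(_ isT)/eqP.
- by apply/andP.
by apply/forallP=> w; apply/implyP=> /andP[/andP[wx wy] lw]; apply/eqP/l_min.
Qed.

(** * Replacing a leaf of a network by a network *)

Section Substitution.

Variables (VQ VM V : finType) (EQ : rel VQ) (EM : rel VM) (E : rel V).
Variables (rQ m : VQ) (rM : VM) (XQ : {set VQ}) (XM : {set VM}).
Hypotheses (gQ : rooted_galled_tree EQ rQ XQ) (gM : rooted_galled_tree EM rM XM).
Hypothesis mX : m \in XQ.
Variables (i : VQ -> V) (j : VM -> V).
Hypotheses (i_inj : injective i) (j_inj : injective j).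
Hypothesis ij : i m = j rM.
Hypothesis ij_inj : forall u w, i u = j w -> u = m /\ w = rM.
Hypothesis ij_cover : forall v, (exists u, v = i u) \/ (exists w, v = j w).
Hypothesis EP : forall v v', E v v' <->
  (exists u u', [/\ v = i u, v' = i u' & EQ u u']) \/
  (exists w w', [/\ v = j w, v' = j w' & EM w w']).

Let acQ : acyclic EQ. Proof. by case: gQ. Qed.
Let acM : acyclic EM. Proof. by case: gM. Qed.

Let m_out u : EQ m u = false.
Proof.
apply/negP=> mu; have := leaf_connect gQ mX (connect1 mu) => um.
by rewrite um in mu; apply: acyclic_irrefl mu.
Qed.

Let m_in : indeg EQ m = 1. Proof. by case: gQ => _ _ /(_ m mX)[]. Qed.

Let rM_in w : EM w rM = false.
Proof.
apply/negP=> wr; have [_ [/eqP + _] _ _ _] := gM.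
by rewrite cards_eq0 => /eqP/setP/(_ w); rewrite !inE wr.
Qed.

Let Ei u u' : E (i u) (i u') = EQ u u'.
Proof.
apply/idP/idP=> [|uu']; last by apply/EP; left; exists u, u'.
case/EP=> [[? [? [/i_inj<- /i_inj<-]]] //|[w [w' [/ij_inj[_ ->] /ij_inj[_ ->]]]]].
by rewrite rM_in.
Qed.

Let Ej w w' : E (j w) (j w') = EM w w'.
Proof.
apply/idP/idP=> [|ww']; last by apply/EP; right; exists w, w'.
case/EP=> [[u [u' [/esym/ij_inj[-> _] /esym/ij_inj[-> _]]]]|[? [? [/j_inj<- /j_inj<-]]] //].
by rewrite m_out.
Qed.

Let Eji w u : E (j w) (i u) = false.
Proof.
apply/negP=> /EP[[? [? [/esym/ij_inj[-> _] _]]]|[? [? [_ /ij_inj[_ ->]]]]].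
  by rewrite m_out.
by rewrite rM_in.
Qed.

Let Eij u w : E (i u) (j w) -> w <> rM -> u = m.
Proof. by case/EP=> [[? [? [_ /esym/ij_inj[_ ->]]]] //|[? [? [/ij_inj[]]]]]. Qed.

Lemma subst_parents_i u : [set v | E v (i u)] = i @: [set v | EQ v u].
Proof.
apply/setP=> v; rewrite inE; apply/idP/imsetP=> [|[v' + ->]]; last by rewrite inE Ei.
case: (ij_cover v) => [[v' ->]|[w ->]]; last by rewrite Eji.
by rewrite Ei => vu; exists v'; rewrite ?inE.
Qed.

Lemma subst_parents_j w : w <> rM -> [set v | E v (j w)] = j @: [set v | EM v w].
Proof.
move=> wr; apply/setP=> v; rewrite inE; apply/idP/imsetP=> [|[v' + ->]]; last by rewrite inE Ej.
case: (ij_cover v) => [[u ->] uw|[v' ->]]; last by rewrite Ej => vw; exists v'; rewrite ?inE.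
have um := Eij uw wr; rewrite um ij Ej in uw *.
by exists rM; rewrite ?inE.
Qed.

Lemma subst_indeg_i u : indeg E (i u) = indeg EQ u.
Proof. by rewrite /indeg subst_parents_i card_imset. Qed.

Lemma subst_indeg_j w : w <> rM -> indeg E (j w) = indeg EM w.
Proof. by move=> wr; rewrite /indeg subst_parents_j // card_imset. Qed.

Lemma subst_outdeg_i u : u <> m -> outdeg E (i u) = outdeg EQ u.
Proof.
move=> um; rewrite /outdeg -(card_imset _ i_inj); congr #|pred_of_set _|.
apply/setP=> v; rewrite inE; apply/idP/imsetP=> [|[v' + ->]]; last by rewrite inE Ei.
case: (ij_cover v) => [[v' ->]|[w ->]]; first by rewrite Ei => vu; exists v'; rewrite ?inE.
case: (eqVneq w rM) => [->|/eqP wr uw]; last by case: um; apply: Eij uw wr.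
by rewrite -ij Ei => uu; exists m; rewrite ?inE.
Qed.

Lemma subst_outdeg_j w : outdeg E (j w) = outdeg EM w.
Proof.
rewrite /outdeg -(card_imset _ j_inj); congr #|pred_of_set _|.
apply/setP=> v; rewrite inE; apply/idP/imsetP=> [|[v' + ->]]; last by rewrite inE Ej.
case: (ij_cover v) => [[u ->]|[v' ->]]; first by rewrite Eji.
by rewrite Ej => vw; exists v'; rewrite ?inE.
Qed.

Lemma subst_connect_i u u' : connect E (i u) (i u') = connect EQ u u'.
Proof.
apply/idP/idP; last exact: connect_homo.
suff H v : connect E (i u) v -> forall u', v = i u' -> connect EQ u u' by move/H; apply.
move=> uv; elim/connect_last_ind: v / uv => [? /i_inj<-|v w _ IH vw w' eqw].
  exact: connect0.
case: (ij_cover v) => [[v' eqv]|[x eqv]]; last by rewrite eqv eqw Eji in vw.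
apply: connect_trans (IH _ eqv) (connect1 _).
by rewrite -Ei -eqv -eqw.
Qed.

Lemma subst_connect_jP w v : connect E (j w) v -> exists2 w', v = j w' & connect EM w w'.
Proof.
apply: (connect_invariant (P := fun v => exists2 w', v = j w' & connect EM w w')); last by exists w.
move=> _ y [x -> wx] xy; case: (ij_cover y) => [[u eqy]|[w' eqy]]; first by rewrite eqy Eji in xy.
by exists w' => //; apply: connect_trans wx (connect1 _); rewrite -Ej -eqy.
Qed.

Lemma subst_connect_j w w' : connect E (j w) (j w') = connect EM w w'.
Proof.
apply/idP/idP; last exact: connect_homo.
by case/subst_connect_jP=> ? /j_inj->.
Qed.

(** A path from the outer network to a non-root vertex of the inserted one passes through the merged
    vertex, from which everything inserted is reachable. *)
Lemma subst_connect_ij u w : w <> rM -> connect E (i u) (j w) = connect EQ u m.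
Proof.
move=> wr; apply/idP/idP=> [|um]; last first.
  apply: (connect_trans (y := i m)); first by rewrite subst_connect_i.
  by rewrite ij subst_connect_j; exact: (root_reaches gM).
move=> uw; have : (exists u', j w = i u') \/ connect EQ u m.
  elim/connect_last_ind: {w wr}(j w) / uw => [|v x uv IH vx]; first by left; exists u.
  case: IH => [[v' eqv]|]; last by right.
  case: (ij_cover x) => [|[w eqx]]; first by left.
  case: (eqVneq w rM) => [wr|/eqP wr]; first by left; exists m; rewrite eqx wr.
  right; rewrite eqv eqx in vx; rewrite -(Eij vx wr) -subst_connect_i -eqv.
  exact: uv.
by case=> // [[u' /esym/ij_inj[]]].
Qed.

Lemma subst_connect_ji w u : u <> m -> connect E (j w) (i u) = false.
Proof. by move=> um; apply/negP=> /subst_connect_jP[? /ij_inj[]]. Qed.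

Lemma subst_acyclic : acyclic E.
Proof.
move=> v v' /EP[[u [u' [-> -> uu']]]|[w [w' [-> -> ww']]]].
  by rewrite subst_connect_i acQ.
by rewrite subst_connect_j acM.
Qed.

(** The merged vertex [i m] is a cut vertex: once it is deleted, no edge joins the two images. *)
Lemma subst_biconnected C : biconnected E C ->
  C \subset i @: [set: VQ] \/ C \subset j @: [set: VM].
Proof.
move=> bC; case: (boolP (C \subset i @: [set: VQ])) => [|/subsetPn[a aC ai]]; first by left.
case: (boolP (C \subset j @: [set: VM])) => [|/subsetPn[b bC' bj]]; first by right.
have /connected_inP con := biconnectedD (i m) bC.
have aD : a \in C :\ i m.
  by rewrite in_setD1 aC andbT; apply: contraNneq ai => ->; rewrite imset_f.
have bD : b \in C :\ i m.
  by rewrite in_setD1 bC' andbT; apply: contraNneq bj => ->; rewrite ij imset_f.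
have : exists2 w, b = j w & w <> rM.
  apply: (connect_invariant (P := fun v => exists2 w, v = j w & w <> rM)) (con _ _ aD bD).
    move=> _ y [w -> wr] /and3P[_ /setD1P[yi yC] wy].
    case: (ij_cover y) => [[u eqy]|[w' eqy]]; last first.
      by exists w' => // w'r; case/eqP: yi; rewrite eqy w'r.
    rewrite eqy Eji /= in wy; case/eqP: yi; rewrite eqy; congr i.
    exact: Eij wy wr.
  case: (ij_cover a) => [[u eqa]|[w eqa]]; first by case/negP: ai; rewrite eqa imset_f.
  by exists w => // wr; case/negP: ai; rewrite eqa wr -ij imset_f.
by case=> w eqb _; case/negP: bj; rewrite eqb imset_f.
Qed.

(** The merged vertex takes indegree 1 from the leaf [m] and its outdegree from the root [rM], so it
    is a tree vertex. For (N4), a biconnected set lies in one of the two images and is pulled back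
    there. *)
Lemma subst_galled (X : {set V}) :
    (forall u, u <> m -> (i u \in X) = (u \in XQ)) ->
    (forall w, (j w \in X) = (w \in XM)) ->
  rooted_galled_tree E (i rQ) X.
Proof.
move=> Xi Xj; have [_ [irQ orQ] leafQ innerQ N4Q] := gQ.
have [_ [irM orM] leafM innerM N4M] := gM.
have rQm : rQ <> m by move=> rm; rewrite rm m_in in irQ.
have hyb_i u : hybrid E (i u) -> u <> m.
  by move=> + um; rewrite um /hybrid subst_indeg_i m_in.
have hyb_j w : hybrid E (j w) -> w <> rM.
  by move=> + wr; rewrite wr -ij => /hyb_i.
split.
- exact: subst_acyclic.
- by rewrite subst_indeg_i subst_outdeg_i.
- move=> v; case: (ij_cover v) => [[u ->]|[w ->]]; last first.
    rewrite Xj => wX; have [ow iw] := leafM w wX.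
    by rewrite subst_outdeg_j subst_indeg_j // => wr; rewrite wr irM in iw.
  case: (eqVneq u m) => [->|/eqP um]; last first.
    by rewrite Xi // => uX; rewrite subst_outdeg_i // subst_indeg_i; exact: leafQ.
  by rewrite ij Xj => /leafM[_]; rewrite irM.
- move=> v; case: (ij_cover v) => [[u ->]|[w ->]].
    case: (eqVneq u m) => [->|/eqP um].
      by move=> _ _; left; rewrite /tree_vertex subst_indeg_i m_in ij subst_outdeg_j.
    rewrite Xi // (inj_eq i_inj) => uX ur.
    rewrite /tree_vertex /hybrid subst_indeg_i subst_outdeg_i //.
    exact: innerQ.
  case: (eqVneq w rM) => [->|wr].
    by move=> _ _; left; rewrite /tree_vertex -ij subst_indeg_i m_in ij subst_outdeg_j.
  rewrite Xj => wX _; rewrite /tree_vertex /hybrid subst_outdeg_j subst_indeg_j; last exact/eqP.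
  exact: innerM.
move=> C bC; case: (subst_biconnected bC) => sC.
  move=> v v' vC v'C; have /imsetP[u _ eqv] := subsetP sC v vC.
  have /imsetP[u' _ eqv'] := subsetP sC v' v'C; rewrite eqv eqv' in vC v'C *.
  move=> hu pu hu' pu'; congr i.
  have [um um'] := (hyb_i _ hu, hyb_i _ hu').
  apply: (N4Q _ (preim_biconnected i_inj Ei sC bC)); rewrite ?inE //.
  - by move: hu; rewrite /hybrid subst_indeg_i subst_outdeg_i.
  - apply/subsetP=> x; rewrite !inE => xu; apply: (subsetP pu); by rewrite inE Ei.
  - by move: hu'; rewrite /hybrid subst_indeg_i subst_outdeg_i.
  apply/subsetP=> x; rewrite !inE => xu; apply: (subsetP pu'); by rewrite inE Ei.
move=> v v' vC v'C; have /imsetP[u _ eqv] := subsetP sC v vC.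
have /imsetP[u' _ eqv'] := subsetP sC v' v'C; rewrite eqv eqv' in vC v'C *.
move=> hu pu hu' pu'; congr j.
have [um um'] := (hyb_j _ hu, hyb_j _ hu').
apply: (N4M _ (preim_biconnected j_inj Ej sC bC)); rewrite ?inE //.
- by move: hu; rewrite /hybrid subst_indeg_j // subst_outdeg_j.
- apply/subsetP=> x; rewrite !inE => xu; apply: (subsetP pu); by rewrite inE Ej.
- by move: hu'; rewrite /hybrid subst_indeg_j // subst_outdeg_j.
apply/subsetP=> x; rewrite !inE => xu; apply: (subsetP pu'); by rewrite inE Ej.
Qed.

Lemma subst_lca_j x y l : is_lca EM x y l -> is_lca E (j x) (j y) (j l).
Proof.
case/is_lcaP=> lx ly l_min; apply/is_lcaP; split; rewrite ?subst_connect_j //.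
move=> _ /subst_connect_jP[w -> lw]; rewrite !subst_connect_j => wx wy; congr j.
exact: l_min.
Qed.

Lemma subst_lca_i x y l : x <> m -> is_lca EQ x y l -> is_lca E (i x) (i y) (i l).
Proof.
move=> xm /is_lcaP[lx ly l_min]; apply/is_lcaP; split; rewrite ?subst_connect_i //.
move=> v; case: (ij_cover v) => [[u ->]|[w ->]]; last by rewrite subst_connect_ji.
by rewrite !subst_connect_i => lu ux uy; congr i; exact: l_min.
Qed.

(** Within the outer network, every inserted vertex other than the root has the same ancestors as
    [m]. *)
Lemma subst_lca_ij x y l : x <> m -> y <> rM -> is_lca EQ x m l -> is_lca E (i x) (j y) (i l).
Proof.
move=> xm yr /is_lcaP[lx ly l_min]; apply/is_lcaP.
split; rewrite ?subst_connect_i ?subst_connect_ij //.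
move=> v; case: (ij_cover v) => [[u ->]|[w ->]]; last by rewrite subst_connect_ji.
by rewrite !subst_connect_i subst_connect_ij // => lu ux uy; congr i; exact: l_min.
Qed.

End Substitution.

(** * Networks explaining a vertex subset *)

Section Explains.

Variables (T : finType) (e : rel T).
Hypothesis sym_e : symmetric e.

(* [hy = false] asks for a network without hybrid vertices. *)
Definition galled_explains (hy : bool) (S : {set T}) : Prop :=
  exists (V : finType) (E : rel V) (r : V) (g : V -> bool) (f : T -> V),
    [/\ rooted_galled_tree E r (f @: S), {in S &, injective f},
        {in S &, forall x y l, x != y -> is_lca E (f x) (f y) l -> e x y = g l}
      & ~~ hy -> forall v, indeg E v <= 1].

(** By uniqueness, a label condition on all lowest common ancestors needs checking for one only. *)
Lemma label_lca_eq (V : finType) (E : rel V) r (X : {set V}) (g : V -> bool) (x y : V) l b :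
  rooted_galled_tree E r X -> (exists2 l', is_lca E x y l' & b = g l') -> is_lca E x y l -> b = g l.
Proof. by move=> gE [l' lP ->] /(is_lca_uniq gE lP)->. Qed.

(** The network is a cherry with root [None] and leaves [Some true] and [Some false]. *)
Lemma galled_explains_pair hy a b : a != b -> galled_explains hy [set a; b].
Proof.
move=> nab; pose E := [rel u v : option bool | ~~ isSome u && isSome v].
pose f x := Some (x == a).
have fS : f @: [set a; b] = [set Some true; Some false].
  by rewrite imsetU1 imset_set1 /f eqxx eq_sym (negPf nab).
have par c : [set u | E u (Some c)] = [set None] by apply/setP=> -[?|]; rewrite !inE.
have parN : [set u | E u None] = set0 by apply/setP=> u; rewrite !inE andbF.
have chi c : [set u | E (Some c) u] = set0 by apply/setP=> u; rewrite !inE.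
have chiN : [set u | E None u] = [set Some true; Some false].
  by apply/setP=> -[[]|]; rewrite !inE.
have ideg v : indeg E v <= 1 by case: v => [c|]; rewrite /indeg ?par ?parN ?cards1 ?cards0.
have nhyb v : hybrid E v = false.
  by apply/negP=> /andP[/eqP iv]; have := ideg v; rewrite iv.
exists (option bool), E, None, (fun=> e a b), f; split=> //.
- split.
  + move=> u v /andP[uN vS]; apply/negP=> vu.
    have : isSome u by apply: (connect_invariant (P := isSome) _ vS vu) => x y _ /andP[].
    by rewrite (negPf uN).
  + by rewrite /indeg /outdeg parN chiN cards0 cards2.
  + by rewrite fS => x /set2P[]->; rewrite /indeg /outdeg par chi cards0 cards1.
  + by rewrite fS => -[[]|]; rewrite !inE.
  by move=> C _ u v _ _; rewrite nhyb.
- by move=> x y /set2P[]-> /set2P[]->; rewrite /f ?eqxx // ?(eq_sym b) (negPf nab).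
by move=> x y /set2P[]-> /set2P[]-> l; rewrite ?eqxx // sym_e.
Qed.

(** Seen from a vertex outside the module, each vertex of [M] may be replaced by the representative
    [m], which accounts for the pairs across; all other pairs keep their lowest common ancestor. *)
Lemma galled_explains_subst hy (S M : {set T}) m : M \subset S -> m \in M ->
    module_in e S M -> galled_explains hy (m |: (S :\: M)) -> galled_explains hy M ->
  galled_explains hy S.
Proof.
move=> sMS mM modM [VQ [EQ [rQ [labQ [fQ [gQ fQ_inj eQ hQ]]]]]].
move=> [VM [EM [rM [labM [fM [gM fM_inj eM hM]]]]]].
set Q := m |: (S :\: M) in gQ fQ_inj eQ.
have mQ : m \in Q by rewrite !inE eqxx.
have QS x : x \in S -> x \notin M -> x \in Q by move=> xS xM; rewrite !inE xM xS orbT.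
pose m' := fQ m; have m'X : m' \in fQ @: Q by exact: imset_f.
have fQm x : x \in S -> x \notin M -> fQ x <> m'.
  by move=> xS xM eqx; have := xM; rewrite (fQ_inj x m (QS x xS xM) mQ eqx) mM.
pose V : finType := (VQ + {y : VM | y != rM})%type.
pose i (u : VQ) : V := inl u.
(* The root [rM] has no copy of its own: [insub] fails on it, and the default merges it with the
   leaf [m']. *)
pose j (w : VM) : V := if insub w is Some y then inr y else inl m'.
have jE w (wr : w != rM) : j w = inr (Sub w wr) by rewrite /j insubT.
have jr : j rM = i m' by rewrite /j insubF // eqxx.
have i_inj : injective i by move=> x y [].
have j_inj : injective j.
  move=> x y; case: (eqVneq x rM) => [->|xr]; case: (eqVneq y rM) => [->|yr] //.
  - by rewrite jr jE.
  - by rewrite jr jE.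
  by rewrite !jE => -[].
have ij_inj u w : i u = j w -> u = m' /\ w = rM.
  by case: (eqVneq w rM) => [->|wr]; [rewrite jr => /i_inj|rewrite jE].
have ij_cover v : (exists u, v = i u) \/ (exists w, v = j w).
  case: v => [u|y]; [by left; exists u|right; exists (val y)].
  by rewrite (jE _ (valP y)); congr inr; exact: val_inj.
pose E := [rel v v' : V |
  [exists p : VQ * VQ, [&& v == i p.1, v' == i p.2 & EQ p.1 p.2]] ||
  [exists p : VM * VM, [&& v == j p.1, v' == j p.2 & EM p.1 p.2]]].
have EP v v' : E v v' <->
    (exists u u', [/\ v = i u, v' = i u' & EQ u u']) \/
    (exists w w', [/\ v = j w, v' = j w' & EM w w']).
  split=> [/orP[]/existsP[[u u'] /and3P[/eqP-> /eqP->]]|[]]; first by left; exists u, u'.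
  - by right; exists u, u'.
  - case=> u [u' [-> -> uu']]; apply/orP; left; apply/existsP; exists (u, u').
    by rewrite !eqxx.
  case=> u [u' [-> -> uu']]; apply/orP; right; apply/existsP; exists (u, u').
  by rewrite !eqxx.
pose f x := if x \in M then j (fM x) else i (fQ x).
(* The merged vertex is now an inner vertex and takes the label of [rM] in place of that of [m']. *)
pose g (v : V) : bool := match v with inl u => if u == m' then labM rM else labQ u
                       | inr y => labM (val y) end.
have gi u : u <> m' -> g (i u) = labQ u by move/eqP=> um; rewrite /= (negPf um).
have gj w : g (j w) = labM w.
  by case: (eqVneq w rM) => [->|wr]; [rewrite jr /= eqxx|rewrite jE].
have fMr x : x \in M -> fM x <> rM.
  move=> xM fr; have [_ [irM _] /(_ (fM x)) leafM _ _] := gM.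
  by case: leafM; rewrite ?imset_f // fr irM.
have ij := esym jr.
have gE : rooted_galled_tree E (i rQ) (f @: S).
  apply: (subst_galled gQ gM m'X i_inj j_inj ij ij_inj ij_cover EP) => [u um|w].
    apply/imsetP/imsetP=> -[x xS].
      rewrite /f; case: ifPn => [xM /ij_inj[]//|xM /i_inj->].
      by exists x; rewrite ?QS.
    move=> eqx; case/setU1P: xS => [xm|/setDP[xS xM]]; first by case: um; rewrite eqx xm.
    by exists x; rewrite // /f (negPf xM) eqx.
  apply/imsetP/imsetP=> -[x xS] => [|->]; last by exists x; rewrite /f ?xS ?(subsetP sMS).
  rewrite /f; case: ifPn => [xM /j_inj->|xM /esym/ij_inj[xm _]]; first by exists x.
  by case: (fQm x).
exists V, E, (i rQ), g, f; split=> //.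
- move=> x y xS yS; rewrite /f; case: ifPn => xM; case: ifPn => yM.
  + by move/j_inj; exact: fM_inj.
  + by move/esym/ij_inj => [/(fQm y yS yM)].
  + by move/ij_inj => [/(fQm x xS xM)].
  by move/i_inj; apply: fQ_inj; exact: QS.
- have cross x y : x \in S -> x \notin M -> y \in M -> exists2 l', is_lca E (i (fQ x)) (j (fM
    y)) l' & e x y = g l'.
    move=> xS xM yM; have [l lP] := ex_lca gQ (fQ x) m'.
    have lm : l <> m'.
      move=> lm; have [lx _ _] := is_lcaP _ _ _ _ lP.
      by case: (fQm x xS xM); apply: (leaf_connect gQ m'X); rewrite -{1}lm.
    exists (i l); first by apply: (subst_lca_ij gQ gM m'X i_inj j_inj ij ij_inj ij_cover EP
      (fQm x xS xM) (fMr y yM)).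
    rewrite (gi _ lm) -(eQ x m (QS x xS xM) mQ l _ lP) //; last by apply: contraNneq xM => ->.
    by rewrite !(sym_e x); apply: modM; rewrite // inE xM.
  move=> x y xS yS l nxy; apply: (label_lca_eq gE).
  rewrite /f; case: ifPn => xM; case: ifPn => yM.
  + have [l' lP] := ex_lca gM (fM x) (fM y); exists (j l'); last by rewrite gj; exact: eM nxy lP.
    by apply: (subst_lca_j gQ gM m'X j_inj ij_inj ij_cover EP).
  + by have [l' lP el'] := cross y x yS yM xM; exists l'; [exact: is_lca_sym|rewrite sym_e].
  + exact: cross.
  have [l' lP] := ex_lca gQ (fQ x) (fQ y); exists (i l').
    by apply: (subst_lca_i gQ gM m'X i_inj j_inj ij_inj ij_cover EP (fQm x xS xM)).
  rewrite gi; first by apply: eQ lP; rewrite ?QS.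
  move=> lm; have [lx _ _] := is_lcaP _ _ _ _ lP.
  by case: (fQm x xS xM); apply: (leaf_connect gQ m'X); rewrite -{1}lm.
move=> nhy v; case: (ij_cover v) => [[u ->]|[w ->]].
  by rewrite (subst_indeg_i gQ gM m'X i_inj ij_inj ij_cover EP) hQ.
case: (eqVneq w rM) => [->|/eqP wr].
  by rewrite jr (subst_indeg_i gQ gM m'X i_inj ij_inj ij_cover EP) hQ.
by rewrite (subst_indeg_j gQ m'X j_inj ij ij_inj ij_cover EP wr) hM.
Qed.

Lemma card_module_quotient (S M : {set T}) m : M \subset S -> m \in M ->
  #|m |: (S :\: M)| = (#|S| - #|M|).+1.
Proof.
by move=> sMS mM; rewrite cardsU1 cardsD (setIidPr sMS) !inE mM.
Qed.

(** When [#|S| > 2], one part of a split has at least two vertices and is a proper module. The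
    module and its quotient are both smaller than [S]. *)
Lemma galled_explains_cograph (S : {set T}) :
  p4free e S -> 1 < #|S| -> galled_explains false S.
Proof.
move: {2}#|S| (leqnn #|S|) => n; elim: n S => [|n IH] S; first by rewrite leqn0 => /eqP->.
move=> leSn frS S2.
have [/eqP/cards2P[a [b [nab ->]]]|nS2] := eqVneq #|S| 2; first exact: galled_explains_pair.
have [M [sMS [M2 MS] modM]] : exists M : {set T}, [/\ M \subset S, 1 < #|M| /\ #|M| < #|S| &
  module_in e S M].
  have [B [sBS B0 BS [b const]]] := p4free_split sym_e frS S2.
  have cB : #|B| < #|S| by rewrite proper_card // properEneq BS.
  have [B1|B1] := ltnP 1 #|B|.
    by exists B; split=> // x y xB yB w wS; rewrite !const.
  have D0 : 0 < #|B| by rewrite card_gt0.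
  have cD := cardsD S B; rewrite (setIidPr sBS) in cD.
  have B1' : #|B| = 1 by apply/eqP; rewrite eqn_leq B1.
  (* When [B] is a singleton, its complement serves as the module. *)
  exists (S :\: B); split; first exact: subsetDl.
    by rewrite cD B1'; case: #|S| S2 nS2 => [|[|[|k]]] // _ _; rewrite subn1.
  move=> x y xD yD w; rewrite setDDr setDv set0U => /setIP[_ wB].
  by rewrite !(sym_e _ w) !const.
have [m mM] : exists m, m \in M by apply/card_gt0P; exact: ltnW.
apply: (galled_explains_subst sMS mM modM); apply: IH; last exact: M2.
- rewrite card_module_quotient // -ltnS; apply: leq_trans leSn.
  by rewrite -[leqRHS](subnK (ltnW MS)) -addn2 leq_add2l.
- by apply: p4freeS frS; rewrite subUset sub1set (subsetP sMS) // subsetDl.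
- by rewrite card_module_quotient // ltnS subn_gt0.
- by rewrite -ltnS; exact: leq_trans leSn.
- exact: p4freeS frS.
Qed.

End Explains.

(* Two trees glued along a leaf [i v1 = j v2], which becomes a hybrid with the
   new leaf [lf] below it, under a common new root [ro]. *)
Record glued (V1 V2 V : finType) (E1 : rel V1) (E2 : rel V2) (E : rel V)
    (r1 v1 : V1) (r2 v2 : V2) (i : V1 -> V) (j : V2 -> V) (ro lf : V) : Prop := Glued {
  glued_injl : injective i;
  glued_injr : injective j;
  glued_eq : i v1 = j v2;
  glued_meet : forall u w, i u = j w -> u = v1 /\ w = v2;
  glued_cover : forall v, [\/ v = ro, v = lf, exists u, v = i u | exists w, v = j w];
  glued_fresh : [/\ ro <> lf, forall u, ro <> i u /\ lf <> i u & forall w, ro <> j w /\ lf <> j w];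
  glued_edge : forall v v', E v v' <->
    [\/ exists u u', [/\ v = i u, v' = i u' & E1 u u'],
        exists w w', [/\ v = j w, v' = j w' & E2 w w'],
        v = ro /\ (v' = i r1 \/ v' = j r2)
      | v = i v1 /\ v' = lf] }.

(** Through this symmetry the facts about the first tree also serve for the second. *)
Lemma glued_sym V1 V2 V E1 E2 E r1 v1 r2 v2 i j ro lf :
  @glued V1 V2 V E1 E2 E r1 v1 r2 v2 i j ro lf ->
  glued E2 E1 E r2 v2 r1 v1 j i ro lf.
Proof.
case=> ii ji ij meet cov [rl fi fj] EP; split=> //.
- by move=> u w /esym/meet[].
- by move=> v; case: (cov v); [constructor 1|constructor 2|constructor 4|constructor 3].
move=> v v'; split=> [/EP|H].
  case; [by constructor 2|by constructor 1|by case=> ->; constructor 3; tauto|].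
  by rewrite ij; constructor 4.
apply/EP; case: H; [by constructor 2|by constructor 1|by case=> ->; constructor 3; tauto|].
by rewrite -ij; constructor 4.
Qed.

(** * Gluing two networks along a leaf, seen from one of them *)

Section GluedSide.

Variables (V1 V2 V : finType) (E1 : rel V1) (E2 : rel V2) (E : rel V).
Variables (r1 v1 : V1) (r2 v2 : V2) (i : V1 -> V) (j : V2 -> V) (ro lf : V).
Variables (X1 : {set V1}) (X2 : {set V2}).
Hypotheses (g1 : rooted_galled_tree E1 r1 X1) (g2 : rooted_galled_tree E2 r2 X2).
Hypotheses (v1X : v1 \in X1) (v2X : v2 \in X2).
Hypothesis gl : glued E1 E2 E r1 v1 r2 v2 i j ro lf.

Let i_inj := glued_injl gl.
Let j_inj := glued_injr gl.
Let ij := glued_eq gl.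
Let meet := glued_meet gl.
Let cov := glued_cover gl.
Let EP := glued_edge gl.
Let ro_lf : ro <> lf. Proof. by case: (glued_fresh gl). Qed.
Let ro_i u : ro <> i u. Proof. by case: (glued_fresh gl) => _ /(_ u)[]. Qed.
Let lf_i u : lf <> i u. Proof. by case: (glued_fresh gl) => _ /(_ u)[]. Qed.
Let ro_j w : ro <> j w. Proof. by case: (glued_fresh gl) => _ _ /(_ w)[]. Qed.
Let lf_j w : lf <> j w. Proof. by case: (glued_fresh gl) => _ _ /(_ w)[]. Qed.

Let leaf_out (U : finType) (F : rel U) r (X : {set U}) x y :
  rooted_galled_tree F r X -> x \in X -> F x y = false.
Proof.
move=> gF xX; apply/negP=> xy; have := leaf_connect gF xX (connect1 xy) => yx.
by rewrite yx in xy; case: gF => acF _ _ _ _; apply: acyclic_irrefl xy.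
Qed.

Let root_in (U : finType) (F : rel U) r (X : {set U}) y :
  rooted_galled_tree F r X -> F y r = false.
Proof.
case=> _ [/eqP + _] _ _ _; rewrite cards_eq0 => /eqP/setP/(_ y).
by rewrite !inE.
Qed.

Lemma glued_root_leaf : r1 <> v1.
Proof. by move=> rv; case: g1 => _ [ir _] /(_ v1 v1X)[_]; rewrite -rv ir. Qed.

Lemma glued_Ei u u' : E (i u) (i u') = E1 u u'.
Proof.
apply/idP/idP=> [|uu']; last by apply/EP; constructor 1; exists u, u'.
case/EP=> [[? [? [/i_inj<- /i_inj<-]]] //|[w [w' [/meet[_ ->] /meet[_ ->]]]]|[/esym/ro_i]//|[_
  /esym/lf_i]//].
by rewrite (leaf_out _ g2).
Qed.

Lemma glued_E_ro v : E v ro = false.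
Proof.
apply/negP=> /EP[[? [? [_ /ro_i]]]//|[? [? [_ /ro_j]]]//|[_ [/ro_i|/ro_j]]//|[_ /ro_lf]//].
Qed.

Lemma glued_lf_E v : E lf v = false.
Proof.
apply/negP=> /EP[[? [? [/lf_i]]]//|[? [? [/lf_j]]]//|[/esym/ro_lf]//|[/lf_i]//].
Qed.

Lemma glued_E_lf v : E v lf -> v = i v1.
Proof.
case/EP=> [[? [? [_ /lf_i]]]//|[? [? [_ /lf_j]]]//|[_ [/lf_i|/lf_j]]//|[]//].
Qed.

Lemma glued_Eji w u : E (j w) (i u) -> u = v1 /\ E2 w v2.
Proof.
case/EP=> [[? [? [/esym/meet[-> _]]]]|[? [? [/j_inj<- /meet[-> ->]]]]|[/esym/ro_j]//|[_
  /esym/lf_i]//] //.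
by rewrite (leaf_out _ g1).
Qed.

Lemma glued_Eij u w : E (i u) (j w) -> w = v2 /\ E1 u v1.
Proof.
case/EP=> [[? [? [/i_inj<- /esym/meet[-> ->]]]]|[? [? [/meet[_ ->]]]]|[/esym/ro_i]//|[_
  /esym/lf_j]//] //.
by rewrite (leaf_out _ g2).
Qed.

Lemma glued_E_root v : E ro v -> v = i r1 \/ v = j r2.
Proof. by case/EP=> [[? [? [/ro_i]]]//|[? [? [/ro_j]]]//|[_]//|[/ro_i]//]. Qed.

Lemma glued_indeg_i u : u <> v1 -> u <> r1 -> indeg E (i u) = indeg E1 u.
Proof.
move=> uv ur; rewrite /indeg -(card_imset _ i_inj); congr #|pred_of_set _|.
apply/setP=> v; rewrite inE; apply/idP/imsetP=> [|[u' + ->]]; last by rewrite inE glued_Ei.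
case: (cov v) => [->|->|[u' ->]|[w ->]]; last by case/glued_Eji.
- by case/glued_E_root=> [/i_inj|/meet[]].
- by rewrite glued_lf_E.
by rewrite glued_Ei => uu'; exists u'; rewrite ?inE.
Qed.

Lemma glued_indeg_root : indeg E (i r1) = 1.
Proof.
apply/eqP/cards1P; exists ro; apply/setP=> v; rewrite !inE.
apply/idP/eqP=> [|->]; last by apply/EP; constructor 3; split=> //; left.
case: (cov v) => [->|->|[u' ->]|[w ->]] //; first by rewrite glued_lf_E.
  by rewrite glued_Ei (root_in _ g1).
by case/glued_Eji=> /glued_root_leaf.
Qed.

Lemma glued_indeg_i_le u : indeg E1 u <= 1 -> u <> v1 -> indeg E (i u) <= 1.
Proof.
by move=> iu uv; case: (eqVneq u r1) => [->|/eqP ur];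
  [rewrite glued_indeg_root|rewrite glued_indeg_i].
Qed.

Lemma glued_outdeg_i u : u <> v1 -> outdeg E (i u) = outdeg E1 u.
Proof.
move=> uv; rewrite /outdeg -(card_imset _ i_inj); congr #|pred_of_set _|.
apply/setP=> v; rewrite inE; apply/idP/imsetP=> [|[u' + ->]]; last by rewrite inE glued_Ei.
case: (cov v) => [->|->|[u' ->]|[w ->]]; first by rewrite glued_E_ro.
- by move/glued_E_lf/i_inj.
- by rewrite glued_Ei => uu'; exists u'; rewrite ?inE.
by case/glued_Eij=> -> uv1; exists v1; rewrite ?inE.
Qed.

(** The merged vertex has one parent in each part; they are distinct because the parts meet only in
    that vertex, which is not its own parent. *)
Lemma glued_hybrid : hybrid E (i v1).
Proof.
have acI : E1 v1 v1 = false by rewrite (leaf_out _ g1).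
apply/andP; split; last first.
  by apply/card_gt0P; exists lf; rewrite inE; apply/EP; constructor 4.
have -> : indeg E (i v1) = #|i @: [set u | E1 u v1] :|: j @: [set w | E2 w v2]|.
  congr #|pred_of_set _|; apply/setP=> v; rewrite !inE; apply/idP/orP.
    case: (cov v) => [->|->|[u' ->]|[w ->]].
    - by case/glued_E_root=> [/i_inj/esym/glued_root_leaf|/meet[_ v2r]] //;
        case: g2 => _ [ir _] /(_ v2 v2X)[_]; rewrite -v2r ir.
    - by rewrite glued_lf_E.
    - by rewrite glued_Ei => uv; left; rewrite imset_f ?inE.
    by case/glued_Eji=> _ wv; right; rewrite imset_f ?inE.
  case=> /imsetP[x + ->]; rewrite inE => xv; first by rewrite glued_Ei.
  by rewrite ij; apply/EP; constructor 2; exists x, v2.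
rewrite cardsU (_ : _ :&: _ = set0); last first.
  apply/setP=> v; rewrite !inE; apply/negP=> /andP[/imsetP[u + ->] /imsetP[w _ /meet[uv _]]].
  by rewrite inE uv acI.
rewrite cards0 subn0 !card_imset //.
case: g1 g2 => _ _ /(_ v1 v1X)[_ iv1] _ _ [_ _ /(_ v2 v2X)[_ iv2] _ _].
by move: iv1 iv2; rewrite /indeg => -> ->.
Qed.

(** Below the merged vertex there is only [lf], so no path leads from one part into the rest of the
    other. *)
Lemma glued_connect_iP u v : connect E (i u) v ->
  (exists2 u', v = i u' & connect E1 u u') \/ (v = lf /\ connect E1 u v1).
Proof.
apply: (connect_invariant (P := fun v => (exists2 u', v = i u' & connect E1 u u') \/
  (v = lf /\ connect E1 u v1))); last by left; exists u.
move=> _ y [[u' -> uu']|[-> _]]; last by rewrite glued_lf_E.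
case: (cov y) => [->|->|[w ->]|[w ->]]; first by rewrite glued_E_ro.
- by move/glued_E_lf/i_inj <-; right.
- by rewrite glued_Ei => u'w; left; exists w => //; apply: connect_trans uu' (connect1 u'w).
case/glued_Eij=> -> u'v; left; exists v1; first by rewrite ij.
exact: connect_trans uu' (connect1 u'v).
Qed.

Lemma glued_connect_i u u' : connect E (i u) (i u') = connect E1 u u'.
Proof.
apply/idP/idP; last by apply: connect_homo; exact: glued_Ei.
by case/glued_connect_iP=> [[? /i_inj<-]|[/esym/lf_i]].
Qed.

Lemma glued_connect_i_lf u : connect E (i u) lf = connect E1 u v1.
Proof.
apply/idP/idP; first by case/glued_connect_iP=> [[? /lf_i]|[]].
rewrite -glued_connect_i => uv; apply: connect_trans uv (connect1 _).
by apply/EP; constructor 4.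
Qed.

Lemma glued_connect_ij u w : connect E (i u) (j w) -> w = v2.
Proof. by case/glued_connect_iP=> [[? /esym/meet[]]|[/esym/lf_j]]. Qed.

Lemma glued_connect_lf v : connect E lf v -> v = lf.
Proof. by case/connect_first=> [//|[w]]; rewrite glued_lf_E. Qed.

Lemma glued_connect_ro v : connect E v ro -> v = ro.
Proof. by case/connect_last=> [//|[w _]]; rewrite glued_E_ro. Qed.

Lemma glued_root_reaches u : connect E ro (i u).
Proof.
apply: (connect_trans (y := i r1)).
  by apply: connect1; apply/EP; constructor 3; split=> //; left.
by rewrite glued_connect_i (root_reaches g1).
Qed.

Lemma glued_lca_i x y l : is_lca E1 x y l -> is_lca E (i x) (i y) (i l).
Proof.
case/is_lcaP=> lx ly l_min; apply/is_lcaP; split; rewrite ?glued_connect_i //.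
move=> w /glued_connect_iP[[u -> lu]|[-> _] /glued_connect_lf/esym/lf_i//].
by rewrite !glued_connect_i => ux uy; congr i; exact: l_min.
Qed.

(** The new leaf [lf] takes over the role of [v1]: within the first part it has the same
    ancestors. *)
Lemma glued_lca_lf x l : is_lca E1 x v1 l -> is_lca E (i x) lf (i l).
Proof.
case/is_lcaP=> lx ly l_min; apply/is_lcaP.
split; rewrite ?glued_connect_i ?glued_connect_i_lf //.
move=> w /glued_connect_iP[[u -> lu]|[-> _] /glued_connect_lf/esym/lf_i//].
by rewrite glued_connect_i glued_connect_i_lf => ux uy; congr i; exact: l_min.
Qed.

End GluedSide.

(** * The glued network as a galled tree *)

Section Glue.

Variables (V1 V2 V : finType) (E1 : rel V1) (E2 : rel V2) (E : rel V).
Variables (r1 v1 : V1) (r2 v2 : V2) (i : V1 -> V) (j : V2 -> V) (ro lf : V).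
Variables (X1 : {set V1}) (X2 : {set V2}).
Hypotheses (g1 : rooted_galled_tree E1 r1 X1) (g2 : rooted_galled_tree E2 r2 X2).
Hypotheses (v1X : v1 \in X1) (v2X : v2 \in X2).
Hypothesis gl : glued E1 E2 E r1 v1 r2 v2 i j ro lf.
Hypotheses (t1 : forall u, indeg E1 u <= 1) (t2 : forall w, indeg E2 w <= 1).

Let gl' := glued_sym gl.

Lemma glued_acyclic : acyclic E.
Proof.
have [[ac1 _ _ _ _] [ac2 _ _ _ _]] := (g1, g2).
have [ro_lf fi fj] := glued_fresh gl.
move=> v v' /(glued_edge gl)[[u [u' [-> -> uu']]]|[w [w' [-> -> ww']]]|[-> v'E]|[-> ->]].
- by rewrite (glued_connect_i g2 v2X gl) ac1.
- by rewrite (glued_connect_i g1 v1X gl') ac2.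
- apply/negP=> /(glued_connect_ro gl) v'r.
  by case: v'E; rewrite v'r; [case: (fi r1)|case: (fj r2)].
by apply/negP=> /(glued_connect_lf gl)/esym; case: (fi v1).
Qed.

(** Both trees are hybrid-free, so the merged vertex is the only hybrid and (N4) is immediate. *)
Lemma glued_galled (X : {set V}) :
    (forall u, u <> v1 -> (i u \in X) = (u \in X1)) ->
    (forall w, w <> v2 -> (j w \in X) = (w \in X2)) ->
    lf \in X -> ro \notin X -> i v1 \notin X ->
  rooted_galled_tree E ro X.
Proof.
move=> Xi Xj lfX roX vX.
have [[_ [ir1 or1] leaf1 inner1 _] [_ [ir2 or2] leaf2 inner2 _]] := (g1, g2).
have rv1 := glued_root_leaf g1 v1X; have rv2 := glued_root_leaf g2 v2X.
have [ro_lf fi fj] := glued_fresh gl; have ij := glued_eq gl.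
have in_ro : indeg E ro = 0.
  by apply/eqP; rewrite cards_eq0; apply/eqP/setP=> v; rewrite !inE (glued_E_ro gl).
have in_lf : indeg E lf = 1.
  apply/eqP/cards1P; exists (i v1); apply/setP=> v; rewrite !inE.
  apply/idP/eqP=> [/(glued_E_lf gl)//|->]; by apply/(glued_edge gl); constructor 4.
have tree_i u : u <> v1 -> u \notin X1 -> tree_vertex E (i u).
  move=> uv uX; rewrite /tree_vertex (glued_outdeg_i g2 v2X gl uv).
  case: (eqVneq u r1) => [->|ur]; first by rewrite (glued_indeg_root g1 g2 v1X v2X gl).
  rewrite (glued_indeg_i g1 g2 v1X v2X gl uv); last exact/eqP.
  by case: (inner1 u uX ur) => // /andP[/eqP iu]; have := t1 u; rewrite iu.
have tree_j w : w <> v2 -> w \notin X2 -> tree_vertex E (j w).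
  move=> uv uX; rewrite /tree_vertex (glued_outdeg_i g1 v1X gl' uv).
  case: (eqVneq w r2) => [->|ur]; first by rewrite (glued_indeg_root g2 g1 v2X v1X gl').
  rewrite (glued_indeg_i g2 g1 v2X v1X gl' uv); last exact/eqP.
  by case: (inner2 w uX ur) => // /andP[/eqP iu]; have := t2 w; rewrite iu.
have hyb v : hybrid E v -> v = i v1.
  case/andP=> /eqP iv _; case: (glued_cover gl v) => [eqv|eqv|[u eqv]|[w eqv]].
  - by rewrite eqv in_ro in iv.
  - by rewrite eqv in_lf in iv.
  - rewrite eqv; congr i; apply/eqP/negP=> /negP/eqP uv.
    by have := glued_indeg_i_le g1 g2 v1X v2X gl (t1 u) uv; rewrite -eqv iv.
  rewrite eqv ij; congr j; apply/eqP/negP=> /negP/eqP wv.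
  by have := glued_indeg_i_le g2 g1 v2X v1X gl' (t2 w) wv; rewrite -eqv iv.
split.
- exact: glued_acyclic.
- split=> //; apply/card_gt1P; exists (i r1), (j r2).
  rewrite !inE; split; try (by apply/(glued_edge gl); constructor 3; split=> //; tauto).
  by apply/eqP=> /(glued_meet gl)[].
- move=> v; case: (glued_cover gl v) => [->|->|[u ->]|[w ->]]; first by rewrite (negPf roX).
  + split=> //; apply/eqP; rewrite cards_eq0; apply/eqP/setP=> v'.
    by rewrite !inE (glued_lf_E gl).
  + case: (eqVneq u v1) => [->|/eqP uv]; first by rewrite (negPf vX).
    rewrite Xi // => uX; have [ou iu] := leaf1 u uX.
    rewrite (glued_outdeg_i g2 v2X gl uv) (glued_indeg_i g1 g2 v1X v2X gl uv) //.
    by move=> ur; rewrite ur ir1 in iu.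
  case: (eqVneq w v2) => [->|/eqP wv]; first by rewrite -ij (negPf vX).
  rewrite Xj // => wX; have [ow iw] := leaf2 w wX.
  rewrite (glued_outdeg_i g1 v1X gl' wv) (glued_indeg_i g2 g1 v2X v1X gl' wv) //.
  by move=> wr; rewrite wr ir2 in iw.
- move=> v; case: (glued_cover gl v) => [->|->|[u ->]|[w ->]]; rewrite ?eqxx ?lfX //.
    case: (eqVneq u v1) => [-> _ _|/eqP uv]; first by right; exact: (glued_hybrid g1 g2 v1X v2X gl).
    by rewrite Xi // => uX _; left; exact: tree_i.
  case: (eqVneq w v2) => [-> _ _|/eqP wv]; first by rewrite -ij; right;
    exact: (glued_hybrid g1 g2 v1X v2X gl).
  by rewrite Xj // => wX _; left; exact: tree_j.
by move=> C _ u v _ _ /hyb-> _ /hyb->.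
Qed.

(** A vertex of one tree reaches nothing outside that tree except [lf], so only [ro] is above both
    vertices. *)
Lemma glued_lca_root x y : x <> v1 -> y <> v2 -> is_lca E (i x) (j y) ro.
Proof.
move=> xv yv; apply/is_lcaP; split.
- exact: (glued_root_reaches g1 g2 v2X gl).
- exact: (glued_root_reaches g2 g1 v1X gl').
move=> v _; case: (glued_cover gl v) => [//|->|[u ->]|[w ->]].
- by have [_ fi _] := glued_fresh gl; move/(glued_connect_lf gl)/esym; case: (fi x).
- by move=> _ /(glued_connect_ij g2 v2X gl).
by move/(glued_connect_ij g1 v1X gl').
Qed.

End Glue.

(** * Sufficiency and the equivalence *)

Section Construction.

Variables (T : finType) (e : rel T).
Hypotheses (sym_e : symmetric e) (irr_e : irreflexive e).

Lemma galled_explains_pseudo_cograph (S : {set T}) :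
  pseudo_cograph_in e S -> galled_explains e true S.
Proof.
case=> S1 [S2 [v [b [SU SI [c1 c2] [fr1 fr2] cross]]]].
have [V1 [E1 [r1 [lab1 [f1 [g1 f1_inj e1 t1]]]]]] := galled_explains_cograph sym_e fr1 c1.
have [V2 [E2 [r2 [lab2 [f2 [g2 f2_inj e2 t2]]]]]] := galled_explains_cograph sym_e fr2 c2.
have /setIP[vS1 vS2] : v \in S1 :&: S2 by rewrite SI set11.
have in12 x : x \in S1 -> x \in S2 -> x = v.
  by move=> x1 x2; apply/set1P; rewrite -SI inE x1.
pose v1 := f1 v; pose v2 := f2 v.
have v1X : v1 \in f1 @: S1 by exact: imset_f.
have v2X : v2 \in f2 @: S2 by exact: imset_f.
have f1v x : x \in S1 -> x != v -> f1 x <> v1.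
  by move=> xS /eqP xv /(f1_inj _ _ xS vS1).
have f2v x : x \in S2 -> x != v -> f2 x <> v2.
  by move=> xS /eqP xv /(f2_inj _ _ xS vS2).
pose V : finType := option (V1 + V2)%type.
pose i (u : V1) : V := Some (inl u).
(* As [v2] is identified with [v1], the slot [inr v2] becomes free and is used for the new leaf
   [lf]. *)
pose j (w : V2) : V := if w == v2 then Some (inl v1) else Some (inr w).
pose ro : V := None; pose lf : V := Some (inr v2).
pose E := [rel x y : V |
  [|| [exists p : V1 * V1, [&& x == i p.1, y == i p.2 & E1 p.1 p.2]],
      [exists p : V2 * V2, [&& x == j p.1, y == j p.2 & E2 p.1 p.2]],
      (x == ro) && ((y == i r1) || (y == j r2))
    | (x == i v1) && (y == lf)]].
have gl : glued E1 E2 E r1 v1 r2 v2 i j ro lf.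
  split.
  - by move=> x y [].
  - by move=> x y; rewrite /j; case: (eqVneq x v2) => [->|_]; case: (eqVneq y v2) => [->|_] // [].
  - by rewrite /j eqxx.
  - by move=> u w; rewrite /j; case: (eqVneq w v2) => [->|_] [] // ->.
  - case=> [[u|w]|]; [by constructor 3; exists u| |by constructor 1].
    case: (eqVneq w v2) => [->|wv]; first by constructor 2.
    by constructor 4; exists w; rewrite /j (negPf wv).
  - split=> // w; rewrite /j; case: (eqVneq w v2) => // wv; split=> // -[] vw.
    by rewrite vw eqxx in wv.
  move=> x y; split.
    case/or4P.
    - by case/existsP=> -[u u'] /and3P[/eqP-> /eqP-> uu']; constructor 1; exists u, u'.
    - by case/existsP=> -[u u'] /and3P[/eqP-> /eqP-> uu']; constructor 2; exists u, u'.
    - by case/andP=> /eqP-> /orP[]/eqP->; constructor 3; split=> //; tauto.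
    by case/andP=> /eqP-> /eqP->; constructor 4.
  case=> [[u [u' [-> -> uu']]]|[u [u' [-> -> uu']]]|[-> [->|->]]|[-> ->]]; apply/or4P.
  - by constructor 1; apply/existsP; exists (u, u'); rewrite !eqxx.
  - by constructor 2; apply/existsP; exists (u, u'); rewrite !eqxx.
  - by constructor 3; rewrite !eqxx.
  - by constructor 3; rewrite !eqxx orbT.
  by constructor 4; rewrite !eqxx.
have gl' := glued_sym gl; have [ii ji] := (glued_injl gl, glued_injr gl).
have [ro_lf fi fj] := glued_fresh gl.
pose f x := if x == v then lf else if x \in S1 then i (f1 x) else j (f2 x).
(* The new root is labeled by [b], the constant adjacency between the two parts. *)
pose g (x : V) : bool := match x with None => b | Some (inl u) => lab1 u | Some (inr w) => lab2
  w end.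
have gj w : w <> v2 -> g (j w) = lab2 w by move/eqP=> wv; rewrite /j (negPf wv).
have fv : f v = lf by rewrite /f eqxx.
have fS1 x : x \in S1 -> x != v -> f x = i (f1 x) by move=> x1 xv; rewrite /f (negPf xv) x1.
have fS2 x : x \in S2 -> x != v -> f x = j (f2 x).
  move=> x2 xv; rewrite /f (negPf xv); case: ifP => // x1.
  by rewrite (in12 x) ?eqxx in xv.
have inS x : x \in S -> [\/ x = v, x \in S1 /\ x != v | x \in S2 /\ x != v].
  rewrite -SU => xS; case: (eqVneq x v) => [|xv]; first by constructor 1.
  by case/setUP: xS; [constructor 2|constructor 3].
have [sS1 sS2] : S1 \subset S /\ S2 \subset S by rewrite -SU subsetUl subsetUr.
have gE : rooted_galled_tree E ro (f @: S).
  apply: (glued_galled g1 g2 v1X v2X gl) => [||u uv|w wv|||]; try by [exact: t1|exact: t2].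
  - apply/imsetP/imsetP=> -[x xS].
      case: (inS x xS) => [->|[x1 xv]|[x2 xv]]; first by rewrite fv => /esym; case: (fi u).
        by rewrite fS1 // => /ii->; exists x.
      by rewrite fS2 // => /(glued_meet gl)[].
    move=> eqx; exists x; first exact: (subsetP sS1).
    by rewrite fS1 // ?eqx //; apply/eqP=> xv; apply: uv; rewrite eqx xv.
  - apply/imsetP/imsetP=> -[x xS].
      case: (inS x xS) => [->|[x1 xv]|[x2 xv]]; first by rewrite fv => /esym; case: (fj w).
        by rewrite fS1 // => /esym/(glued_meet gl)[].
      by rewrite fS2 // => /ji->; exists x.
    move=> eqx; exists x; first exact: (subsetP sS2).
    by rewrite fS2 // ?eqx //; apply/eqP=> xv; apply: wv; rewrite eqx xv.
  - by rewrite -fv imset_f // (subsetP sS1).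
  - apply/negP=> /imsetP[x xS]; case: (inS x xS) => [->|[x1 xv]|[x2 xv]].
    + by rewrite fv.
    + by rewrite fS1.
    by rewrite fS2 //; case: (fj (f2 x)).
  apply/negP=> /imsetP[x xS]; case: (inS x xS) => [->|[x1 xv]|[x2 xv]].
  + by rewrite fv.
  + by rewrite fS1 // => /ii/esym/(f1v x x1 xv).
  by rewrite fS2 // => /(glued_meet gl)[_ /(f2v x x2 xv)].
have lca1 x y l : x \in S1 -> x != v -> is_lca E1 (f1 x) y l -> l <> v1.
  move=> x1 xv /is_lcaP[lx _ _] lv; apply: (f1v x x1 xv).
  by apply: (leaf_connect g1 v1X); rewrite -lv.
have lca2 x y l : x \in S2 -> x != v -> is_lca E2 (f2 x) y l -> l <> v2.
  move=> x2 xv /is_lcaP[lx _ _] lv; apply: (f2v x x2 xv).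
  by apply: (leaf_connect g2 v2X); rewrite -lv.
(* Pairs within one part are settled by the tree of that part, with [lf] standing for [v]; pairs
   across are settled by the root. *)
pose ok x y := exists2 l, is_lca E (f x) (f y) l & e x y = g l.
have ok_sym x y : ok x y -> ok y x.
  by case=> l lP el; exists l; [exact: is_lca_sym|rewrite sym_e].
have ok1v x : x \in S1 -> x != v -> ok x v.
  move=> x1 xv; have [l lP] := ex_lca g1 (f1 x) v1; exists (i l).
    by rewrite fS1 // fv; exact: (glued_lca_lf g2 v2X gl).
  exact: e1 lP.
have ok2v x : x \in S2 -> x != v -> ok x v.
  move=> x2 xv; have [l lP] := ex_lca g2 (f2 x) v2; exists (j l).
    by rewrite fS2 // fv; exact: (glued_lca_lf g1 v1X gl').
  rewrite gj; last exact: lca2 lP.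
  exact: e2 lP.
have ok11 x y : x \in S1 -> x != v -> y \in S1 -> y != v -> x != y -> ok x y.
  move=> x1 xv y1 yv nxy; have [l lP] := ex_lca g1 (f1 x) (f1 y); exists (i l).
    by rewrite !fS1 //; exact: (glued_lca_i g2 v2X gl).
  exact: e1 lP.
have ok22 x y : x \in S2 -> x != v -> y \in S2 -> y != v -> x != y -> ok x y.
  move=> x1 xv y1 yv nxy; have [l lP] := ex_lca g2 (f2 x) (f2 y); exists (j l).
    by rewrite !fS2 //; exact: (glued_lca_i g1 v1X gl').
  rewrite gj; last exact: lca2 lP.
  exact: e2 lP.
have ok12 x y : x \in S1 -> x != v -> y \in S2 -> y != v -> ok x y.
  move=> x1 xv y2 yv; exists ro; last by apply: cross; rewrite in_setD1 ?xv ?yv.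
  rewrite fS1 // fS2 //; apply: (glued_lca_root g1 g2 v1X v2X gl); [exact: f1v|exact: f2v].
have ok_all x y : x \in S -> y \in S -> x != y -> ok x y.
  move=> xS yS nxy.
  case: (inS x xS) => [xv|[x1 xv]|[x2 xv]]; case: (inS y yS) => [yv|[y1 yv]|[y2 yv]].
  - by rewrite xv yv eqxx in nxy.
  - by rewrite xv; apply: ok_sym; exact: ok1v.
  - by rewrite xv; apply: ok_sym; exact: ok2v.
  - by rewrite yv; exact: ok1v.
  - exact: ok11.
  - exact: ok12.
  - by rewrite yv; exact: ok2v.
  - by apply: ok_sym; exact: ok12.
  exact: ok22.
exists V, E, ro, g, f; split=> //.
- move=> x y xS yS.
  case: (inS x xS) => [->|[x1 xv]|[x2 xv]]; case: (inS y yS) => [->|[y1 yv]|[y2 yv]] //.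
  + by rewrite fv (fS1 y) //; case: (fi (f1 y)).
  + by rewrite fv (fS2 y) //; case: (fj (f2 y)).
  + by rewrite fv (fS1 x) // => /esym; case: (fi (f1 x)).
  + by rewrite !fS1 // => /ii; exact: f1_inj.
  + by rewrite (fS1 x) // (fS2 y) // => /(glued_meet gl)[/(f1v x x1 xv)].
  + by rewrite fv (fS2 x) // => /esym; case: (fj (f2 x)).
  + by rewrite (fS2 x) // (fS1 y) // => /esym/(glued_meet gl)[/(f1v y y1 yv)].
  by rewrite !fS2 // => /ji; exact: f2_inj.
by move=> x y xS yS l nxy; apply: (label_lca_eq gE); exact: ok_all.
Qed.

Lemma p4free_small (S : {set T}) : #|S| <= 3 -> p4free e S.
Proof.
move=> S3 a b c d aS bS cS dS ab bc cd ac bd ad.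
have /card_uniqP u4 := p4_uniq sym_e ab bc cd ac bd ad.
suff : 4 <= #|S| by rewrite ltnNge S3.
rewrite -[4]u4; apply/subset_leq_card/subsetP=> x.
by rewrite !inE => /or4P[]/eqP->.
Qed.

(** A nontrivial module and its quotient are smaller subsets of [S], so they inherit the hypothesis
    on primitive subsets. Without such a module [S] is itself primitive. Sets of at most three
    vertices contain no P4 and are explained by trees. *)
Lemma galled_explains_of_primitives (S : {set T}) : 1 < #|S| ->
    (forall A : {set T}, A \subset S -> primitive_in e A -> pseudo_cograph_in e A) ->
  galled_explains e true S.
Proof.
move: {2}#|S| (leqnn #|S|) => n; elim: n S => [|n IH] S; first by rewrite leqn0 => /eqP->.
move=> leSn S2 prims; have [S3|S4] := leqP #|S| 3.
  have [V [E [r [g [f [gE f_inj eE _]]]]]] := galled_explains_cograph sym_e (p4free_small S3) S2.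
  by exists V, E, r, g, f.
(* A boolean form of nontrivial modules, which makes their existence decidable. *)
pose modb (M : {set T}) := [&& M \subset S, 1 < #|M|, #|M| < #|S| &
  [forall x in M, forall y in M, forall w in S :\: M, e x w == e y w]].
case: (boolP [exists M, modb M]) => [/existsP[M /and4P[sMS M2 MS modM]]|nmod]; last first.
  apply/galled_explains_pseudo_cograph/prims => //; split=> // M sMS M0 modM.
  case: (eqVneq M S) => [|nMS]; [by right|left].
  apply/eqP; rewrite eqn_leq card_gt0 M0 andbT leqNgt; apply: contra nmod => M2.
  apply/existsP; exists M; rewrite /modb sMS M2 proper_card ?properEneq ?nMS //=.
  apply/forall_inP=> x xM; apply/forall_inP=> y yM; apply/forall_inP=> w wS.
  by apply/eqP; exact: modM.
have [m mM] : exists m, m \in M by apply/card_gt0P; exact: ltnW.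
have sQS : m |: (S :\: M) \subset S by rewrite subUset sub1set (subsetP sMS) // subsetDl.
have sub (A B : {set T}) : B \subset S -> A \subset B -> primitive_in e A -> pseudo_cograph_in e A.
  by move=> sBS sAB; apply: prims; exact: subset_trans sBS.
apply: (galled_explains_subst sym_e sMS mM).
- move=> x y xM yM w wS; apply/eqP.
  by have /forall_inP/(_ x xM)/forall_inP/(_ y yM)/forall_inP/(_ w wS) := modM.
- apply: IH => [||A sA]; last exact: (sub A _ _ sA).
    rewrite card_module_quotient // -ltnS; apply: leq_trans leSn.
    by rewrite -[leqRHS](subnK (ltnW MS)) -addn2 leq_add2l.
  by rewrite card_module_quotient // ltnS subn_gt0.
apply: IH => // [|A sA]; last exact: (sub A _ _ sA).
by rewrite -ltnS; exact: leq_trans leSn.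
Qed.

Lemma GaTEx_of_explains : 0 < #|T| -> galled_explains e true [set: T] -> GaTEx e.
Proof.
case/card_gt0P=> x0 _ [V [E [r [g [f [gE f_inj eE _]]]]]].
pose X := f @: [set: T]; have fX x : f x \in X by exact: imset_f.
have inj_f : injective f by move=> x y; apply: f_inj; rewrite inE.
exists V, E, X, (fun v => if v \in X then None else Some (g v)); split.
- by apply: (rooted_galled_treeW _ gE); apply/set0Pn; exists (f x0).
- by move=> v; case: ifP.
have h_inj : injective (fun x => Sub (f x) (fX x) : {v | v \in X}).
  by move=> x y /(congr1 val)/inj_f.
exists (fun x => Sub (f x) (fX x)).
  apply: (inj_card_bij h_inj); rewrite card_sig -cardsT -(card_imset _ inj_f).
  by rewrite leq_eqVlt; apply/orP; left; apply/eqP/eq_card=> v.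
move=> x y; rewrite /explained /= (inj_eq h_inj); case: (eqVneq x y) => [->|nxy] /=.
  by rewrite irr_e.
have [l lP] := ex_lca gE (f x) (f y); rewrite (lcaE gE lP) (eE x y _ _ l nxy lP) ?inE //.
(* A lowest common ancestor in [X] would equal both [f x] and [f y]; distinct vertices thus always
   receive a label from [g]. *)
case: ifPn => [lX|_]; last by case: (g l).
have [lx ly _] := is_lcaP _ _ _ _ lP.
have fx := leaf_connect gE lX lx; have fy := leaf_connect gE lX ly.
by rewrite -fy in fx; rewrite (inj_f _ _ fx) eqxx in nxy.
Qed.

(** This uses the network with one vertex and no edge, which [rooted_galled_tree] excludes. *)
Lemma GaTEx_single : #|T| = 1 -> GaTEx e.
Proof.
case/eqP/fintype1P=> x0 Tx0.
exists unit, [rel _ _ | false], [set tt], (fun=> None); split.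
- split; [by apply/set0Pn; exists tt; rewrite inE|by []|].
  by left; exists tt; split=> //; apply/setP=> -[]; rewrite !inE.
- by move=> []; rewrite inE.
exists (fun=> Sub tt (set11 tt)).
  exists (fun=> x0) => [x|[[] p]]; first by rewrite (Tx0 x).
  exact: val_inj.
by move=> x y; rewrite (Tx0 x) (Tx0 y) irr_e.
Qed.

Lemma GaTEx_primitive (A : {set T}) : GaTEx e -> primitive_in e A -> pseudo_cograph_in e A.
Proof.
case=> V [E [X [t [gX _ [h h_bij h_mono]]]]] primA.
have h_inj := bij_inj h_bij.
have hX x : val (h x) \in X := valP (h x).
have vh_inj : injective (val \o h) by exact: (inj_comp val_inj).
case: (galled_tree_rooted gX) => [V1|[r gE]].
  (* A one-vertex network has too few leaves for a set of at least four vertices. *)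
  have [A3 _] := primA; have := leq_card _ vh_inj; rewrite V1 => T1.
  by have := leq_trans A3 (leq_trans (max_card _) T1).
apply: (explained_primitive (f := val \o h) (g := fun l => t l == Some true) gE) => //.
by move=> x y l nxy lP; rewrite -h_mono /explained /= (inj_eq h_inj) nxy (lcaE gE lP).
Qed.

End Construction.

Theorem mainTheorem2 (T : finType) (e : rel T) (hT : 0 < #|T|)
    (he : simple_graph e) :
  GaTEx e <->
  forall A : {set T}, primitive (induced e A) -> pseudo_cograph (induced e A).
Proof.
have [sym_e irr_e] := he; split=> [gat A /primitive_induced primA|prims].
  apply/(pseudo_cograph_induced sym_e irr_e); last exact: GaTEx_primitive.
  by case: primA => /ltnW.
have [T2|T1] := ltnP 1 #|T|; last first.
  by apply: GaTEx_single => //; apply/eqP; rewrite eqn_leq T1.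
apply: GaTEx_of_explains => //; apply: galled_explains_of_primitives; rewrite ?cardsT //.
move=> A _ primA; apply/(pseudo_cograph_induced sym_e irr_e).
  by case: primA => /ltnW.
by apply/prims/primitive_induced.
Qed.
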